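(* Let $n\geq 2$ and let $W= \frac{1}{2} \sqrt{1+\frac{1}{n}}\left(\mathrm{Tr}(g)+\overline{\mathrm{Tr}(g)} \right)$, where $g$ is random from Dyson's circular orthogonal ensemble of $n\times n$ matrices and $\mathrm{Tr}$ denotes trace. Then for all real $x_0$, $$\left| \mathbb{P}(W \leq x_0) - \frac{1}{\sqrt{2 \pi}} \int_{-\infty}^{x_0}e^{-\frac{x^2}{2}}\, dx \right| \leq \frac{4}{n}.$$
   Context: Dyson's circular orthogonal ensemble is the symmetric space $U(n,\mathbb{C})/O(n,\mathbb{R})$ with its invariant probability measure, identified with the set of $n\times n$ symmetric unitary matrices via $u\mapsto uu^T$; i.e. the random matrix is $uu^T$ with $u$ Haar distributed on $U(n,\mathbb{C})$. If $f$ depends only on the eigenvalues $x_1,\dots,x_n$ of the matrix, its expectation is $$\frac{[\Gamma(3/2)]^n}{\Gamma(\frac{n}{2}+1)} \int_{\mathbb{T}^n}f(x_1,\dots,x_n) \prod_{1 \leq i<j \leq n} |x_i-x_j| \prod_{k=1}^n\frac{dx_k}{2 \pi},$$ where $\mathbb{T}^n=\{(x_1,\dots,x_n)\in\mathbb{C}^n: |x_i|=1\}$ and $dx_k$ denotes arc length (angular) measure on the unit circle. The trace is $x_1+\cdots+x_n$. *)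

(* Defs.v *)
From HB Require Import structures.
From mathcomp Require Import all_boot all_order all_algebra spectral.
From mathcomp Require Import complex.
From mathcomp Require Import all_classical all_reals all_analysis.

Set Implicit Arguments.
Unset Strict Implicit.
Unset Printing Implicit Defensive.

Import Order.TTheory GRing.Theory Num.Theory.
Import numFieldNormedType.Exports.

Local Open Scope classical_set_scope.
Local Open Scope ring_scope.
Local Open Scope complex_scope.

(* MathComp-Analysis attaches the norm topology to variables of type
   numClosedFieldType, but not to the concrete type R[i]. *)
HB.instance Definition _ (R : realType) :=
  PseudoPointedMetric.copy R[i] (R[i] : numClosedFieldType)^o.

(* 'M[R[i]]_n with its Borel sigma-algebra. *)
Definition borel_mx (R : realType) (n : nat) :=
  g_sigma_algebraType (@open 'M[R[i]]_n).

(* The Haar probability measure of the compact group U(n), seen as a Borel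
   probability measure on all n x n matrices that is carried by U(n). *)
Definition haar_unitary (R : realType) (n : nat)
    (mu : probability (borel_mx R n) R) : Prop :=
  mu [set u : 'M[R[i]]_n | u \is unitarymx] = 1%E /\
  forall (v : 'M[R[i]]_n) (A : set (borel_mx R n)),
    v \is unitarymx -> measurable A -> mu [set v *m u | u in A] = mu A.

(* g has the law of u *m u^T for u Haar distributed on U(n). *)
Definition circular_orthogonal_ensemble (R : realType) (n : nat)
    (d : measure_display) (T : measurableType d) (P : probability T R)
    (g : {RV P >-> borel_mx R n}) : Prop :=
  exists2 mu : probability (borel_mx R n) R, haar_unitary mu &
    forall A : set (borel_mx R n), measurable A ->
      distribution P g A = mu [set u : 'M[R[i]]_n | A (u *m u^T)].

(* The argument of complex.Re is a real number: taking its real part only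
   changes its type from R[i] to R. *)
Definition scaled_trace (R : realType) (n : nat) (g : 'M[R[i]]_n) : R :=
  complex.Re
    (2^-1 * (Num.sqrt (1 + n%:R^-1))%:C * (\tr g + (\tr g)^*)).

(* Main.v *)
(* Stein's method with an infinitesimal exchangeable pair. Let g = u u^T with u
   Haar distributed on U(n), p_k = tr g^k and W = sqrt (1 + 1/n) Re p_1. Left
   invariance of Haar measure makes every directional derivative of a function
   of u have mean zero; applied to the field (j, k) |-> g_jk F(W) this gives
     E[W F(W)] = E[F'(W) (1 - Re p_2 / n)],
   so that E[F'(W) - W F(W)] = E[F'(W) Re p_2] / n. The fields (g^2)_jk conj p_2
   and g_jk p_1 conj p_2 yield two linear relations between E |p_2|^2,
   E [p_1^2 conj p_2] and E |p_1|^2, which force E |p_2|^2 <= 4 and hence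
   E |Re p_2| <= 2. For F the solution of Stein's equation for a continuous
   approximation of an indicator function, |F'| <= 2, whence the bound 4 / n. *)
Require Import Defs.
From HB Require Import structures.
From mathcomp Require Import all_boot all_order all_algebra spectral.
From mathcomp Require Import complex.
From mathcomp Require Import all_classical all_reals all_analysis.
From mathcomp Require Import measurable_realfun ring lra.

Import Order.TTheory GRing.Theory Num.Theory.
Import numFieldNormedType.Exports.

Local Open Scope classical_set_scope.
Local Open Scope ring_scope.

(** * Stein's equation *)

Section gaussian.
Context {R : realType}.
Implicit Types x y w a e : R.
Notation leb := (@lebesgue_measure R).

(** The scaling sqrt (1 + 1/n) is exactly what gives F'(W) the coefficient 1 in the identity for
    E[W F(W)]: its square times n / (n + 1) is 1. The obstacle is that elementary matrices are not
    tangent to U(n), so the derivative along (j, k) is not taken along a curve in the group. The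
    tangent directions used are i a a^* for complex vectors a. The mean derivative in such a
    direction is a sesquilinear form in a whose coefficients are the means of the derivatives along
    elementary matrices; if it vanishes for all a, polarization kills each coefficient. The Cayley
    transform of i t a a^* is an explicit curve in U(n), rational in t because the square of a a^*
    is a multiple of it. Differentiability then means a first order expansion in t whose O(t^2)
    remainder is uniform over U(n) for each a. This notion is stable under sums, products,
    conjugation and composition with Stein solutions. The bound on F' does not depend on the width
    of the ramp that replaces the indicator, so this width can tend to 0 at no cost. *)

Definition gam x : R := expR (- (x ^+ 2 / 2)).

Lemma gam_gt0 x : 0 < gam x. Proof. exact: expR_gt0. Qed.

Lemma gam_le1 x : gam x <= 1.
Proof. by rewrite -expR0 ler_expR oppr_le0 divr_ge0// sqr_ge0. Qed.

Lemma is_derive_gam x : is_derive x 1 gam (- x * gam x).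
Proof.
rewrite /gam; apply: is_derive_eq.
rewrite /GRing.scale/=; lra.
Qed.

Lemma is_derive_continuous (f : R -> R) (df : R -> R) :
  (forall x, is_derive x 1 f (df x)) -> continuous f.
Proof.
move=> fdf x; apply/differentiable_continuous/derivable1_diffP.
by case: (fdf x).
Qed.

Lemma continuous_gam : continuous gam.
Proof. exact: is_derive_continuous is_derive_gam. Qed.

Lemma ger0_is_derive_ndecr (f df : R -> R) a :
  (forall x, is_derive x 1 f (df x)) -> (forall x, a < x -> 0 <= df x) ->
  forall x, a <= x -> f a <= f x.
Proof.
move=> fdf df0 x ax; apply: (@ger0_derive1_ndecry _ f a) => //.
- move=> y; rewrite in_itv/= andbT derive1E => ay; have ? := fdf y.
  by rewrite derive_val; exact: df0.
- by apply: continuous_subspaceT; exact: is_derive_continuous fdf.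
Qed.

Lemma gam_cvgy : gam x @[x --> +oo] --> 0.
Proof.
apply: (@squeeze_cvgr _ _ _ _ (fun=> 0) (fun x => expR (- x))); last 2 first.
- exact: cvg_cst.
- exact: cvgr_expR.
near=> x; rewrite ltW ?gam_gt0//= ler_expR lerN2.
have : 2 <= x by near: x; exact: nbhs_pinfty_ge.
by move=> x2; nra.
Unshelve. all: by end_near. Qed.

Lemma mills_y (Psi psi : R -> R) :
  (forall x, is_derive x 1 Psi (psi x * gam x)) -> (forall x, `|psi x| <= 1) ->
  Psi x @[x --> +oo] --> 0 -> forall w, 0 <= w -> - (w * Psi w) <= gam w.
Proof.
move=> dPsi psi1 Psi0 w w0; rewrite -subr_ge0 opprK.
(* gam + w Psi is nonincreasing on [w, +oo[ and tends to 0. *)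
pose F x := - (gam x + w * Psi x).
have dF x : is_derive x 1 F ((x - w * psi x) * gam x).
  have := is_derive_gam x; have := dPsi x => ? ?.
  by rewrite /F; apply: is_derive_eq; rewrite /GRing.scale/=; lra.
have F0 : F x @[x --> +oo] --> 0.
  rewrite -oppr0 -[in X in _ --> X](addr0 0) -[X in _ --> - (_ + X)](mulr0 w).
  by apply: cvgN; apply: cvgD; [exact: gam_cvgy|apply: cvgMr].
suff : F w <= 0 by rewrite /F oppr_le0.
apply: (cvgr_to_ge F0); near=> x.
apply: (ger0_is_derive_ndecr _ _ w dF) => [y wy|]; last first.
  by near: x; apply: nbhs_pinfty_ge; exact: num_real.
apply: mulr_ge0; last exact/ltW/gam_gt0.
have := psi1 y; rewrite ler_norml => /andP[_ y1].
nra.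
Unshelve. all: by end_near. Qed.

(** Generalizes the Mills ratio bound for w times the Gaussian tail beyond w, the integrand being
    weighted by [psi]. Negative w reduces to positive w by reflection, and the upper bound to the
    lower one by changing the sign of [Psi]. Divided by [gam], it becomes |x F x| <= 1 for the Stein
    solution F. *)
Lemma mills (Psi psi : R -> R) :
  (forall x, is_derive x 1 Psi (psi x * gam x)) -> (forall x, `|psi x| <= 1) ->
  Psi x @[x --> +oo] --> 0 -> Psi x @[x --> -oo] --> 0 ->
  forall w, `|w * Psi w| <= gam w.
Proof.
have pos Psi' psi' : (forall x, is_derive x 1 Psi' (psi' x * gam x)) ->
    (forall x, `|psi' x| <= 1) -> Psi' x @[x --> +oo] --> 0 ->
    forall w, 0 <= w -> `|w * Psi' w| <= gam w.
  move=> dPsi psi1 Psi0 w w0; rewrite ler_norml lerNl (mills_y _ _ dPsi)//=.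
  have := @mills_y (fun x => - Psi' x) (fun x => - psi' x).
  move=> /(_ _ _ _ w w0); rewrite mulrN opprK; apply.
  - by move=> x; have := dPsi x => ?; apply: is_derive_eq; rewrite mulNr.
  - by move=> x; rewrite normrN.
  - by rewrite -oppr0; exact: cvgN.
move=> dPsi psi1 Psiy PsiNy w; have [w0|w0] := leP 0 w; first exact: (pos _ psi).
have gamN x : gam (- x) = gam x by rewrite /gam sqrrN.
have -> : w * Psi w = - (- w * (Psi \o -%R) (- w)) by rewrite /= opprK mulNr opprK.
rewrite normrN -gamN.
apply: (pos (Psi \o -%R) (fun x => - psi (- x))) => //.
- move=> x; apply: is_derive_eq.
  by rewrite gamN /GRing.scale/=; lra.
- by move=> x; rewrite normrN.
- exact/cvgNy_compNP.
- by rewrite oppr_ge0 ltW.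
Qed.

(** * The Gaussian integral as a normal distribution function *)

Lemma normal_pdf_gam x : normal_pdf 0 1 x = (Num.sqrt (2 * pi))^-1 * gam x.
Proof.
rewrite normal_pdfE ?oner_neq0// /normal_peak /normal_fun /gam expr1n mul1r.
by rewrite mulr_natl subr0 mulNr.
Qed.

Lemma sqrt2pi_gt0 : 0 < Num.sqrt (2 * pi) :> R.
Proof. by rewrite sqrtr_gt0 mulr_gt0// pi_gt0. Qed.

Lemma integrable_gam (D : set R) : measurable D -> leb.-integrable D (EFin \o gam).
Proof.
move=> mD; apply: (@integrableS _ _ _ _ setT) => //.
have /(integrableZl measurableT (Num.sqrt (2 * pi))) :=
  @integrable_normal_pdf R 0 1.
apply: eq_integrable => // x _ /=.
by rewrite normal_pdf_gam -EFinM mulVKf// gt_eqF ?sqrt2pi_gt0.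
Qed.

Definition Gam w : R := \int[leb]_(x in `]-oo, w]) gam x.

(** Seen as a random variable under the normal law, the identity has [Gam], up to normalization, as
    its distribution function. The upper bound and both limits of [Gam] are read off from this. *)
Let idR : measurableTypeR R -> R := idfun.
#[local] HB.instance Definition _ :=
  @isMeasurableFun.Build _ _ _ _ idR (@measurable_id _ _ setT).

Lemma cdf_Gam w :
  cdf (idR : {RV (normal_prob 0 1 : probability _ _) >-> R}) w =
  ((Num.sqrt (2 * pi))^-1 * Gam w)%:E.
Proof.
rewrite /= preimage_id -[LHS]/(\int[leb]_(x in `]-oo, w]) _)%E.
under eq_integral do rewrite normal_pdf_gam.
rewrite -RintegralZl//; last exact: integrable_gam.
rewrite fineK//; apply: integrable_fin_num => //.
under [X in _.-integrable _ X]eq_fun do rewrite /= EFinM.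
by apply: integrableZl => //; exact: integrable_gam.
Qed.

Lemma Gam_le w : Gam w <= Num.sqrt (2 * pi).
Proof.
have := cdf_le1 (idR : {RV (normal_prob 0 1 : probability _ _) >-> R}) w.
by rewrite cdf_Gam lee_fin ler_pdivrMl ?sqrt2pi_gt0// mulr1.
Qed.

Lemma Gam_cvgy : Gam x @[x --> +oo] --> Num.sqrt (2 * pi).
Proof.
have := cvg_cdfy1 (idR : {RV (normal_prob 0 1 : probability _ _) >-> R}).
rewrite (funext cdf_Gam).
move=> /fine_cvgP[_] /= /(cvgM (cvg_cst (Num.sqrt (2 * pi)))).
rewrite mulr1; apply: cvg_trans; apply: near_eq_cvg; near=> x.
by rewrite /= mulVKf// gt_eqF ?sqrt2pi_gt0.
Unshelve. all: by end_near. Qed.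

Lemma Gam_cvgNy : Gam x @[x --> -oo] --> 0.
Proof.
have := cvg_cdfNy0 (idR : {RV (normal_prob 0 1 : probability _ _) >-> R}).
rewrite (funext cdf_Gam).
move=> /fine_cvgP[_] /= /(cvgM (cvg_cst (Num.sqrt (2 * pi)))).
rewrite mulr0; apply: cvg_trans; apply: near_eq_cvg; near=> x.
by rewrite /= mulVKf// gt_eqF ?sqrt2pi_gt0.
Unshelve. all: by end_near. Qed.

Lemma is_derive_Rintegral (h : R -> R) x : continuous h ->
  leb.-integrable [set: R] (EFin \o h) ->
  is_derive x 1 (fun w => \int[leb]_(y in `]-oo, w]) h y) (h x).
Proof.
move=> ch ih; have := @continuous_FTC1 R h -oo%O x (x + 1).
rewrite ltrDl => /(_ ltr01) [|||dF dFE].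
- exact: integrableS ih.
- by rewrite ltNyr.
- exact: ch.
- by rewrite derive1E in dFE; exact: (DeriveDef dF dFE).
Qed.

Lemma is_derive_Gam x : is_derive x 1 Gam (gam x).
Proof.
apply: is_derive_Rintegral; first exact: continuous_gam.
exact: integrable_gam.
Qed.

Lemma is_derive_lipschitz (f df : R -> R) (K : R) x y :
  (forall z : R, is_derive z 1 f (df z)) -> (forall z, `|df z| <= K) ->
  `|f x - f y| <= K * `|x - y|.
Proof.
move=> fdf dfK; wlog yx : x y / y <= x.
  by move=> wl; have [/wl//|/ltW/wl] := leP y x; rewrite distrC (distrC x).
have [|z _ ->] := @MVT_segment R f df y x yx (fun z _ => fdf z).
- by apply: continuous_subspaceT; exact: is_derive_continuous fdf.
- by rewrite normrM ler_wpM2r.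
Qed.

(** * Ramp functions and the solution of Stein's equation *)

Definition clamp (x : R) : R := Num.max 0 (Num.min 1 x).

Lemma clampP x : 0 <= clamp x <= 1.
Proof. by rewrite /clamp /Num.max /Num.min; do 2 case: ifPn; lra. Qed.

Lemma clamp_le0 x : x <= 0 -> clamp x = 0.
Proof. by rewrite /clamp /Num.max /Num.min; do 2 case: ifPn; lra. Qed.

Lemma clamp_ge1 x : 1 <= x -> clamp x = 1.
Proof. by rewrite /clamp /Num.max /Num.min; do 2 case: ifPn; lra. Qed.

Lemma clamp_lipschitz x y : `|clamp x - clamp y| <= `|x - y|.
Proof.
have x1 := ler_norm (x - y); have x2 := ler_norm (- (x - y)).
rewrite normrN in x2.
rewrite ler_norml /clamp /Num.max /Num.min.
by apply/andP; split; (do 4 case: ifPn => //); lra.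
Qed.

Lemma lipschitz_continuous (h : R -> R) (K : R) :
  (forall x y, `|h x - h y| <= K * `|x - y|) -> continuous h.
Proof.
move=> hK x; apply/cvgrPdist_le => /= e e0.
have K1 : 0 < `|K| + 1 by rewrite ltr_wpDl.
near=> y; apply: (le_trans (hK _ _)).
apply: (@le_trans _ _ ((`|K| + 1) * `|x - y|)).
  by rewrite ler_wpM2r// (le_trans (ler_norm K))// lerDl.
rewrite -ler_pdivlMl// mulrC; near: y.
by apply: cvgr_dist_le; [exact: cvg_id|rewrite divr_gt0].
Unshelve. all: by end_near. Qed.

(* The last clause makes F a C^{1,1} function on bounded intervals, so that
   first order expansions of F have a quadratic remainder. *)
Definition stein_test (F dF : R -> R) : Prop :=
  [/\ forall x : R, is_derive x 1 F (dF x), continuous dF,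
      forall x, `|dF x| <= 2 &
      forall B, exists L, forall x y, `|x| <= B -> `|y| <= B ->
        `|dF x - dF y| <= L * `|x - y|].

(** [g] is the ramp falling linearly from 1 at a to 0 at a + e, and F is obtained by variation of
    constants: exp (x^2 / 2) times the integral of (g - c) [gam] up to x. Comparing g with the
    indicators of the half-lines ending at a and a + e locates c. *)
Lemma stein_solution a e : 0 < e ->
  exists g F dF : R -> R, exists c : R,
  [/\ stein_test F dF,
      forall x, dF x - x * F x = g x - c &
      (Num.sqrt (2 * pi))^-1 * Gam a <= c <= (Num.sqrt (2 * pi))^-1 * Gam (a + e)] /\
  [/\ continuous g, forall x, 0 <= g x <= 1, forall x, x <= a -> g x = 1 &
      forall x, a + e <= x -> g x = 0].
Proof.
move=> e0; pose g x := clamp ((a + e - x) / e).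
have g01 x : 0 <= g x <= 1 by exact: clampP.
have ga x : x <= a -> g x = 1.
  by move=> xa; apply: clamp_ge1; rewrite ler_pdivlMr//; lra.
have gae x : a + e <= x -> g x = 0.
  by move=> xa; apply: clamp_le0; rewrite ler_pdivrMr//; lra.
have glip x y : `|g x - g y| <= e^-1 * `|x - y|.
  apply: (le_trans (clamp_lipschitz _ _)).
  have -> : (a + e - x) / e - (a + e - y) / e = e^-1 * (y - x) by ring.
  by rewrite normrM distrC ger0_norm// invr_ge0 ltW.
have cg : continuous (fun x => g x * gam x).
  move=> x; apply: cvgM; last exact: continuous_gam.
  exact: (@lipschitz_continuous g _ glip).
have ig : leb.-integrable setT (EFin \o (fun x => g x * gam x)).
  apply: le_integrable (integrable_gam _ measurableT) => //.
    by apply/measurable_EFinP; exact: continuous_measurable_fun.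
  move=> x _ /=; rewrite lee_fin normrM ler_piMl//.
  by have /andP[? ?] := g01 x; rewrite ger0_norm.
pose G w := \int[leb]_(y in `]-oo, w]) (g y * gam y).
have dG x : is_derive x 1 G (g x * gam x) by exact: is_derive_Rintegral.
have gg0 x : 0 <= g x * gam x.
  by have /andP[? ?] := g01 x; rewrite mulr_ge0// ltW// gam_gt0.
have G0 x : 0 <= G x by exact: Rintegral_ge0.
have GGam x : G x <= Gam x.
  apply: le_Rintegral => //; [exact: integrableS ig|exact: integrable_gam|].
  move=> y _; have /andP[? ?] := g01 y.
  by rewrite ler_piMl// ltW// gam_gt0.
have Ga : G a = Gam a.
  apply: eq_Rintegral => x; rewrite inE/= in_itv/= => xa.
  by rewrite ga// mul1r.
have Gae x : a + e <= x -> G x = G (a + e).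
  move=> aex; apply/eqP; rewrite eq_le; apply/andP; split.
    rewrite -lerN2.
    have dGN y : is_derive y 1 (fun z => - G z) (- (g y * gam y)).
      by have := dG y => ?; apply: is_derive_eq.
    apply: (ger0_is_derive_ndecr _ _ _ dGN) => // y /ltW aey.
    by rewrite gae// mul0r oppr0.
  exact: (ger0_is_derive_ndecr _ _ _ dG).
pose s : R := Num.sqrt (2 * pi); have s0 : 0 < s := sqrt2pi_gt0.
(* As g vanishes beyond a + e, [G (a + e)] is the whole integral, so c is the Gaussian mean of g.
   This choice makes [Psi] vanish at +oo as well as at -oo. *)
pose c := s^-1 * G (a + e).
have sG x y : (s^-1 * x <= s^-1 * y) = (x <= y) by rewrite ler_pM2l ?invr_gt0.
have c01 : 0 <= c <= 1.
  rewrite /c mulr_ge0 ?invr_ge0 ?(ltW s0)//= ler_pdivrMl// mulr1.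
  exact: le_trans (GGam _) (Gam_le _).
pose Psi x := G x - c * Gam x; pose psi x := g x - c.
have dPsi x : is_derive x 1 Psi (psi x * gam x).
  have := dG x; have := is_derive_Gam x => ? ?.
  by apply: is_derive_eq; rewrite /GRing.scale/= /psi; ring.
have psi1 x : `|psi x| <= 1.
  by have := g01 x; rewrite ler_norml /psi; lra.
have Psiy : Psi x @[x --> +oo] --> 0.
  have -> : 0 = G (a + e) - c * s by rewrite /c mulrAC mulVf ?mul1r ?subrr// gt_eqF.
  apply: cvgB; last by apply: cvgM; [exact: cvg_cst|exact: Gam_cvgy].
  apply: cvg_near_cst; near=> x; apply: Gae; near: x.
  by apply: nbhs_pinfty_ge; exact: num_real.
have PsiNy : Psi x @[x --> -oo] --> 0.
  rewrite -(subr0 0) -[X in _ - X](mulr0 c); apply: cvgB; last first.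
    by apply: cvgM; [exact: cvg_cst|exact: Gam_cvgNy].
  apply: (@squeeze_cvgr _ _ _ _ (fun=> 0) Gam); last exact: Gam_cvgNy.
    by near=> x; rewrite G0 GGam.
  exact: cvg_cst.
pose f x := Psi x * expR (x ^+ 2 / 2); pose df x := x * f x + psi x.
have gamV x : gam x * expR (x ^+ 2 / 2) = 1.
  by rewrite /gam -expRD addNr expR0.
have fdf x : is_derive x 1 f (df x).
  have := dPsi x => ?; apply: is_derive_eq.
  rewrite /GRing.scale/= /df /f; have := gamV x.
  move: (gam x) (expR _) => p q pq.
  transitivity (x * (Psi x * q) + psi x * (p * q)); last by rewrite pq mulr1.
  by field.
have xf1 x : `|x * f x| <= 1.
  rewrite /f mulrA normrM (ger0_norm (expR_ge0 _)).
  apply: (@le_trans _ _ (gam x * expR (x ^+ 2 / 2))); last by rewrite gamV.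
  by rewrite ler_wpM2r ?expR_ge0// (mills _ _ dPsi).
(* The two summands x f x and g x - c of [df x] are each at most 1 in absolute value. *)
have df2 x : `|df x| <= 2.
  by rewrite (le_trans (ler_normD _ _))// (_ : 2 = 1 + 1)// lerD.
have ctsg : continuous g := @lipschitz_continuous g _ glip.
exists g, f, df, c; split; last by split.
split; last 2 first.
- by move=> x; rewrite /df /psi; ring.
- by rewrite /c !sG -Ga GGam andbT; apply: (ger0_is_derive_ndecr _ _ _ dG);
    rewrite // lerDl ltW.
split=> //.
  move=> x; apply: cvgD; last by apply: cvgB; [exact: ctsg|exact: cvg_cst].
  by apply: cvgM; [exact: cvg_id|exact: is_derive_continuous fdf _].
(* The three summands come from the 2-Lipschitz f multiplied by |x| <= M, from the bound of f on
   [-M, M], and from the slope 1 / e of the ramp. *)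
move=> M; exists (2 * M + (`|f 0| + 2 * M) + e^-1) => x y xM yM.
have -> : df x - df y = x * (f x - f y) + (x - y) * f y + (g x - g y).
  by rewrite /df /psi; ring.
rewrite [leRHS]mulrDl [X in _ <= X + _]mulrDl.
apply: le_trans (ler_normD _ _) _; apply: lerD; last exact: glip.
apply: le_trans (ler_normD _ _) _; apply: lerD.
  rewrite normrM (mulrC 2) -mulrA ler_pM//.
  exact: is_derive_lipschitz fdf _.
rewrite normrM mulrC ler_wpM2r//.
rewrite -[f y](subrK (f 0)) addrC (le_trans (ler_normD _ _))// lerD//.
rewrite (le_trans (is_derive_lipschitz _ _ _ _ _ fdf df2))// subr0.
by rewrite ler_wpM2l.
Unshelve. all: by end_near. Qed.

End gaussian.

(** * Measurability on the space of complex matrices *)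

Local Open Scope complex_scope.

Local Notation Re := complex.Re.
Local Notation Im := complex.Im.

Section measurability.
Context {R : realType} {n : nat}.
Notation C := R[i].
Notation M := 'M[C]_n.
Implicit Types (u v : M) (f g : M -> C).

Lemma norm_ic : `|'i%C : C| = 1.
Proof. by rewrite normc_def/= expr0n/= add0r expr1n sqrtr1. Qed.

Lemma norm_realc (x : R) : `|x%:C| = `|x|%:C.
Proof. by rewrite normc_def/= expr0n/= addr0 sqrtr_sqr. Qed.

Lemma conj_ic : conjc ('i%C : C) = - 'i%C.
Proof. by rewrite /conjc; simpc. Qed.

Lemma normc_ge_Im (x : C) : `|Im x|%:C <= `|x|.
Proof.
have := normc_ge_Re (x * 'i%C).
by rewrite ReiNIm normrN normrM norm_ic mulr1.
Qed.

(** Radii live in R[i]; in its partial order [0 < e] already forces e to be real. *)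
Lemma mem_mx_ball (x : M) (e : C) (y : M) :
  ball x e y <-> 0 < e /\ forall i j, `|x i j - y i j| < e.
Proof. by []. Qed.

Lemma open_mx (A : set M) : (forall u, A u -> exists2 e : C, 0 < e &
  forall w : M, (forall i j, `|u i j - w i j| < e) -> A w) -> open A.
Proof.
move=> hA; rewrite openE => u /hA[e e0 he].
by apply/nbhs_ballP; exists e => // w /mem_mx_ball[_]; exact: he.
Qed.

Lemma mx_open (A : set M) u : open A -> A u -> exists2 e : C, 0 < e &
  forall w : M, (forall i j, `|u i j - w i j| < e) -> A w.
Proof.
rewrite openE => hA /hA/nbhs_ballP[e e0 he].
by exists e => // w h; apply: he; apply/mem_mx_ball.
Qed.

Lemma open_measurable_mx (A : set M) :
  open A -> measurable (A : set (borel_mx R n)).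
Proof. by move=> oA; exact: sub_sigma_algebra. Qed.

(** The additive contraction p stands for both the real and the imaginary part. *)
Lemma measurable_entry (p : C -> R) (i j : 'I_n) : {morph p : x y / x - y} ->
  (forall x, `|p x|%:C <= `|x|) ->
  measurable_fun [set: borel_mx R n] (fun u : borel_mx R n => p (u i j)).
Proof.
move=> pB p1; apply: (measurability _ (RGenOInfty.measurableE R)).
move=> _ [_ [x ->] <-]; rewrite setTI; apply: open_measurable_mx.
apply: open_mx => u /=; rewrite in_itv/= andbT => xu.
exists (p (u i j) - x)%:C; first by rewrite ltcR subr_gt0.
move=> w /(_ i j) /(le_lt_trans (p1 _)); rewrite ltcR pB in_itv/= andbT => h.
have := ler_norm (p (u i j) - p (w i j)); lra.
Qed.

Definition cmeasurable f :=
  measurable_fun [set: borel_mx R n] (fun u : borel_mx R n => Re (f u)) /\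
  measurable_fun [set: borel_mx R n] (fun u : borel_mx R n => Im (f u)).

Lemma complex_ReB : {morph (@Re R) : x y / x - y}. Proof. by case=> ? ? [? ?]. Qed.
Lemma complex_ImB : {morph (@Im R) : x y / x - y}. Proof. by case=> ? ? [? ?]. Qed.
Lemma complex_ReD : {morph (@Re R) : x y / x + y}. Proof. by case=> ? ? [? ?]. Qed.
Lemma complex_ImD : {morph (@Im R) : x y / x + y}. Proof. by case=> ? ? [? ?]. Qed.
Lemma complex_ReM (x y : C) : Re (x * y) = Re x * Re y - Im x * Im y.
Proof. by case: x y => ? ? [? ?]. Qed.
Lemma complex_ImM (x y : C) : Im (x * y) = Re x * Im y + Im x * Re y.
Proof. by case: x y => ? ? [? ?]. Qed.

Lemma conjcD (x y : C) : conjc (x + y) = conjc x + conjc y.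
Proof. exact: rmorphD. Qed.
Lemma conjcB (x y : C) : conjc (x - y) = conjc x - conjc y.
Proof. exact: rmorphB. Qed.
Lemma conjcM (x y : C) : conjc (x * y) = conjc x * conjc y.
Proof. exact: rmorphM. Qed.
Lemma conjc_sum (I : Type) (r : seq I) (P : pred I) (F : I -> C) :
  conjc (\sum_(i <- r | P i) F i) = \sum_(i <- r | P i) conjc (F i).
Proof. exact: rmorph_sum. Qed.

Lemma cmeasurable_entry i j : cmeasurable (fun u => u i j).
Proof.
by split; apply: measurable_entry => //;
  [exact: complex_ReB|exact: normc_ge_Re|exact: complex_ImB|exact: normc_ge_Im].
Qed.

Lemma cmeasurable_cst (k : C) : cmeasurable (fun=> k).
Proof. by split; exact: measurable_cst. Qed.

Lemma cmeasurable_real (f : M -> R) :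
  measurable_fun [set: borel_mx R n] (f : borel_mx R n -> R) ->
  cmeasurable (fun u => (f u)%:C).
Proof. by move=> mf; split => //=; exact: measurable_cst. Qed.

Lemma cmeasurableD f g :
  cmeasurable f -> cmeasurable g -> cmeasurable (fun u => f u + g u).
Proof.
move=> [f1 f2] [g1 g2]; split.
- by under eq_fun do rewrite complex_ReD; exact: measurable_funD.
- by under eq_fun do rewrite complex_ImD; exact: measurable_funD.
Qed.

Lemma cmeasurableM f g :
  cmeasurable f -> cmeasurable g -> cmeasurable (fun u => f u * g u).
Proof.
move=> [f1 f2] [g1 g2]; split.
- by under eq_fun do rewrite complex_ReM; apply: measurable_funB; exact: measurable_funM.
- by under eq_fun do rewrite complex_ImM; apply: measurable_funD; exact: measurable_funM.
Qed.

Lemma cmeasurable_conj f : cmeasurable f -> cmeasurable (fun u => conjc (f u)).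
Proof.
move=> [f1 f2]; split.
- by apply: eq_measurable_fun f1 => u _; case: (f u).
- apply: (eq_measurable_fun (fun u : borel_mx R n => - Im (f u))).
    by move=> u _; case: (f u).
  exact: measurableT_comp.
Qed.

Lemma cmeasurable_sum (I : Type) (r : seq I) (F : I -> M -> C) :
  (forall i, cmeasurable (F i)) -> cmeasurable (fun u => \sum_(i <- r) F i u).
Proof.
move=> mF; elim: r => [|i r IHr].
  by under eq_fun do rewrite big_nil; exact: cmeasurable_cst.
by under eq_fun do rewrite big_cons; exact: cmeasurableD.
Qed.

Definition unitary_set : set (borel_mx R n) := [set u : M | u \is unitarymx].

Lemma unitary_conjP u : u \is unitarymx <->
  forall i j, \sum_k u i k * conjc (u j k) = (i == j)%:R.
Proof.
split=> [/unitarymxP/matrixP uu i j|uu].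
  have := uu i j; rewrite !mxE => <-; apply: eq_bigr => k _.
  by rewrite !mxE.
apply/unitarymxP/matrixP => i j; rewrite !mxE -uu; apply: eq_bigr => k _.
by rewrite !mxE.
Qed.

(** U(n) is the zero set of one measurable real function, the sum of the squared moduli of the
    entries of u u^* - 1. *)
Lemma measurable_unitary : measurable unitary_set.
Proof.
pose d i j u : C := \sum_k u i k * conjc (u j k) - (i == j)%:R.
have md i j : cmeasurable (d i j).
  apply: cmeasurableD; last exact: cmeasurable_cst.
  apply: cmeasurable_sum => k; apply: cmeasurableM.
    exact: cmeasurable_entry.
  by apply: cmeasurable_conj; exact: cmeasurable_entry.
pose N (u : borel_mx R n) : R :=
  \sum_i \sum_j (Re (d i j u) ^+ 2 + Im (d i j u) ^+ 2).
have mN : measurable_fun [set: borel_mx R n] N.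
  apply: measurable_sum => i; apply: measurable_sum => j.
  by have [? ?] := md i j; apply: measurable_funD; exact: measurable_funX.
rewrite (_ : unitary_set = N @^-1` [set 0]).
  by rewrite -[X in measurable X]setTI; exact: mN.
have sq0 i j u : 0 <= Re (d i j u) ^+ 2 + Im (d i j u) ^+ 2.
  by rewrite addr_ge0// sqr_ge0.
apply/seteqP; split=> u /=.
  move/unitary_conjP => uu; rewrite /N big1// => i _; rewrite big1// => j _.
  by rewrite /d uu subrr/= expr0n/= addr0.
move=> /eqP; rewrite /N psumr_eq0 => [/allP u0|i _]; last exact: sumr_ge0.
apply/unitary_conjP => i j; apply/eqP; rewrite -subr_eq0 -/(d i j u).
have := u0 i (mem_index_enum _); rewrite psumr_eq0//= => /allP/(_ j).
rewrite mem_index_enum => /(_ erefl) /=; rewrite paddr_eq0 ?sqr_ge0//.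
by rewrite !sqrf_eq0 eq_complex.
Qed.

Lemma measurable_mulmx v :
  measurable_fun [set: borel_mx R n] (fun u : borel_mx R n => v *m u : borel_mx R n).
Proof.
apply: (@measurability _ _ (borel_mx R n) (borel_mx R n) setT _ (@open M)).
  by [].
move=> _ [A oA <-].
rewrite setTI; apply: open_measurable_mx; apply: open_mx => u /= Au.
have [e e0 he] := mx_open _ _ oA Au.
(* [K] dominates every row sum of |v|, and 1 + K is a safe denominator even when v = 0. *)
pose K : C := \sum_i \sum_k `|v i k|.
have K0 : 0 <= K by apply: sumr_ge0 => i _; exact: sumr_ge0.
exists (e / (1 + K)); first by rewrite divr_gt0// ltr_wpDr.
move=> w uw; apply: he => i j; rewrite !mxE -sumrB.
apply: (le_lt_trans (ler_norm_sum _ _ _)).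
apply: (@le_lt_trans _ _ (K * (e / (1 + K)))); last first.
  by rewrite mulrCA gtr_pMr// ltr_pdivrMr ?ltr_wpDr// mul1r ltrDr.
rewrite {1}/K [X in _ <= X * _](bigD1 i)//= mulrDl ler_wpDr//.
  apply: mulr_ge0; first by apply: sumr_ge0 => l _; exact: sumr_ge0.
  by rewrite divr_ge0 ?addr_ge0 ?(ltW e0).
rewrite mulr_suml; apply: ler_sum => k _.
by rewrite -mulrBr normrM ler_wpM2l// ltW.
Qed.

End measurability.

(** * Expectation under Haar measure *)

Lemma Rintegral_invariant {d} {X : measurableType d} {R : realType}
    (mu : {measure set X -> \bar R}) (L : X -> X) (D : set X) (f : X -> R) :
  measurable_fun setT L -> measurable D -> L @^-1` D = D ->
  (forall A, measurable A -> mu (L @^-1` A) = mu A) ->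
  measurable_fun setT f -> mu.-integrable D (EFin \o (f \o L)) ->
  \int[mu]_(x in D) f (L x) = \int[mu]_(x in D) f x.
Proof.
move=> mL mD LD muL mf intf; rewrite /Rintegral; congr fine.
transitivity (\int[pushforward mu L]_(x in D) (f x)%:E)%E.
  have mEf : measurable_fun [set: X] (EFin \o f) by exact/measurable_EFinP.
  by rewrite (integral_pushforward mL mEf) ?LD.
by apply: eq_measure_integral => A mA _; exact: muL.
Qed.

Section expectation.
Context {R : realType} {n : nat} (mu : probability (borel_mx R n) R).
Context (haar_mu : haar_unitary mu).
Notation C := R[i].
Notation M := 'M[C]_n.
Implicit Types (u v : M) (f g : M -> R) (phi psi : M -> C).

(** The bound is asked on U(n) only, since polynomials in the entries are in general unbounded on
    the space of all matrices; accordingly [rE] integrates over [unitary_set], which has full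
    measure. *)
Definition rbmeas f :=
  measurable_fun [set: borel_mx R n] (f : borel_mx R n -> R) /\
  exists K, forall u, u \is unitarymx -> `|f u| <= K.

Lemma rbmeas_cst (k : R) : rbmeas (fun=> k).
Proof. by split; [exact: measurable_cst|exists `|k|]. Qed.

Lemma rbmeasD f g : rbmeas f -> rbmeas g -> rbmeas (fun u => f u + g u).
Proof.
move=> [mf [K fK]] [mg [L gL]]; split; first exact: measurable_funD.
by exists (K + L) => u uU; rewrite (le_trans (ler_normD _ _))// lerD ?fK ?gL.
Qed.

Lemma rbmeasM f g : rbmeas f -> rbmeas g -> rbmeas (fun u => f u * g u).
Proof.
move=> [mf [K fK]] [mg [L gL]]; split; first exact: measurable_funM.
by exists (K * L) => u uU; rewrite normrM ler_pM ?fK ?gL.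
Qed.

Lemma rbmeasZ (k : R) f : rbmeas f -> rbmeas (fun u => k * f u).
Proof. exact: rbmeasM (rbmeas_cst k). Qed.

Lemma rbmeas_comp (h : R -> R) (K : R) f : continuous h -> (forall x, `|h x| <= K) ->
  rbmeas f -> rbmeas (fun u => h (f u)).
Proof.
move=> ch hK [mf _]; split; last by exists K.
exact: (measurableT_comp (continuous_measurable_fun ch) mf).
Qed.

Definition rE f : R := \int[mu]_(u in unitary_set) f u.

Lemma integrable_rbmeas f : rbmeas f -> mu.-integrable unitary_set (EFin \o f).
Proof.
move=> [mf [K fK]]; apply: measurable_bounded_integrable => //.
- exact: measurable_unitary.
- by rewrite (le_lt_trans (probability_le1 _ measurable_unitary))// ltry.
- exact: measurable_funTS.
- exists K; split; first exact: num_real.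
  by move=> y Ky u /= /fK/le_trans; apply; exact: ltW.
Qed.

Lemma rED f g : rbmeas f -> rbmeas g -> rE (fun u => f u + g u) = rE f + rE g.
Proof.
by move=> hf hg; apply: RintegralD;
  [exact: measurable_unitary|exact: integrable_rbmeas..].
Qed.

Lemma rEZ (k : R) f : rbmeas f -> rE (fun u => k * f u) = k * rE f.
Proof.
by move=> hf; apply: RintegralZl;
  [exact: measurable_unitary|exact: integrable_rbmeas].
Qed.

Lemma rE_cst (k : R) : rE (fun=> k) = k.
Proof.
rewrite /rE Rintegral_cst; last exact: measurable_unitary.
have U1 : mu unitary_set = 1%E by case: haar_mu.
rewrite -[RHS]mulr1; congr (_ * _).
by transitivity (fine (1%E : \bar R)) => //; congr fine; exact: U1.
Qed.

Lemma eq_rE f g : (forall u, u \is unitarymx -> f u = g u) -> rE f = rE g.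
Proof. by move=> fg; apply: eq_Rintegral => u; rewrite inE => /fg. Qed.

Lemma le_rE f g : rbmeas f -> rbmeas g ->
  (forall u, u \is unitarymx -> f u <= g u) -> rE f <= rE g.
Proof.
move=> hf hg fg; rewrite /rE; apply: le_Rintegral => //.
- exact: measurable_unitary.
- exact: integrable_rbmeas.
- exact: integrable_rbmeas.
Qed.

Lemma rE_norm_le f (K : R) : rbmeas f ->
  (forall u, u \is unitarymx -> `|f u| <= K) -> `|rE f| <= K.
Proof.
move=> hf fK; rewrite -(rE_cst K).
apply: (le_trans (le_normr_Rintegral measurable_unitary (integrable_rbmeas _ hf))).
apply: (le_rE (fun u => `|f u|)) => //.
  have [mf _] := hf; split; first exact: measurableT_comp.
  by exists K => u /fK; rewrite normr_id.
exact: rbmeas_cst.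
Qed.

(** * Left invariance of the expectation *)

Lemma unitary_adj v : v \is unitarymx -> (v^t*)%sesqui \is unitarymx.
Proof. by rewrite trmxC_unitary. Qed.

Lemma unitary_mul v u : v \is unitarymx ->
  (v *m u \is unitarymx) = (u \is unitarymx).
Proof.
move=> vU; apply/idP/idP => [vuU|]; last exact: mul_unitarymx.
have vtU := unitary_adj _ vU.
rewrite -(mul1mx u) -(mulmx1C (unitarymxP vU)) -mulmxA.
exact: mul_unitarymx vtU vuU.
Qed.

Lemma mulmx_preimage v (A : set M) : v \is unitarymx ->
  (fun u : M => v *m u) @^-1` A = [set (v^t*)%sesqui *m u | u in A].
Proof.
move=> vU; have vv : (v^t*)%sesqui *m v = 1%:M.
  by apply: mulmx1C; exact/unitarymxP.
apply/seteqP; split=> u /=.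
  by move=> Avu; exists (v *m u) => //; rewrite mulmxA vv mul1mx.
by move=> [w Aw <-]; rewrite mulmxA (unitarymxP vU) mul1mx.
Qed.

(** [haar_unitary] speaks of images, a change of variables of preimages; the preimage under v is the
    image under the adjoint of v. *)
Lemma haar_preimage v (A : set (borel_mx R n)) : v \is unitarymx -> measurable A ->
  mu ((fun u : M => v *m u) @^-1` A) = mu A.
Proof.
move=> vU mA; rewrite mulmx_preimage//.
exact: (proj2 haar_mu _ _ (unitary_adj _ vU) mA).
Qed.

Lemma rbmeas_mulmx v f : v \is unitarymx -> rbmeas f ->
  rbmeas (fun u => f (v *m u)).
Proof.
move=> vU [mf [K fK]]; split.
  exact: (measurableT_comp mf (measurable_mulmx v)).
by exists K => u uU; apply: fK; rewrite unitary_mul.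
Qed.

Lemma rE_mulmx v f : v \is unitarymx -> rbmeas f ->
  rE (fun u => f (v *m u)) = rE f.
Proof.
move=> vU hf; apply: (Rintegral_invariant mu (fun u => v *m u)).
- exact: measurable_mulmx.
- exact: measurable_unitary.
- apply/seteqP; split=> u uU.
    change (u \is unitarymx); rewrite -(unitary_mul _ _ vU); exact: uU.
  change (v *m u \is unitarymx); rewrite (unitary_mul _ _ vU); exact: uU.
- by move=> A; exact: haar_preimage.
- by case: hf.
- exact: (integrable_rbmeas (fun u => f (v *m u)) (rbmeas_mulmx _ _ vU hf)).
Qed.

(** * Complex-valued expectations *)

Definition cbmeas phi :=
  cmeasurable phi /\ exists K, forall u, u \is unitarymx -> `|phi u| <= K.

Lemma cbmeas_Re phi : cbmeas phi -> rbmeas (fun u => Re (phi u)).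
Proof.
move=> [[mphi _] [K phiK]]; split=> //; exists (Re K) => u /phiK phiuK.
by have := le_trans (normc_ge_Re _) phiuK; rewrite lecE => /andP[].
Qed.

Lemma cbmeas_Im phi : cbmeas phi -> rbmeas (fun u => Im (phi u)).
Proof.
move=> [[_ mphi] [K phiK]]; split=> //; exists (Re K) => u /phiK phiuK.
by have := le_trans (normc_ge_Im _) phiuK; rewrite lecE => /andP[].
Qed.

Lemma cbmeas_cst (k : C) : cbmeas (fun=> k).
Proof. by split; [exact: cmeasurable_cst|exists `|k|]. Qed.

Lemma cbmeasD phi psi : cbmeas phi -> cbmeas psi -> cbmeas (fun u => phi u + psi u).
Proof.
move=> [mf [K fK]] [mg [L gL]]; split; first exact: cmeasurableD.
exists (K + L) => u uU.
by rewrite (le_trans (ler_normD _ _))// lerD ?fK ?gL.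
Qed.

Lemma cbmeasM phi psi : cbmeas phi -> cbmeas psi -> cbmeas (fun u => phi u * psi u).
Proof.
move=> [mf [K fK]] [mg [L gL]]; split; first exact: cmeasurableM.
by exists (K * L) => u uU; rewrite normrM ler_pM ?fK ?gL.
Qed.

Lemma cbmeas_conj phi : cbmeas phi -> cbmeas (fun u => conjc (phi u)).
Proof.
move=> [mf [K fK]]; split; first exact: cmeasurable_conj.
by exists K => u uU; rewrite normcJ fK.
Qed.

Lemma cbmeas_sum (I : Type) (r : seq I) (F : I -> M -> C) :
  (forall i, cbmeas (F i)) -> cbmeas (fun u => \sum_(i <- r) F i u).
Proof.
move=> nF; elim: r => [|i r IHr].
  by under eq_fun do rewrite big_nil; exact: cbmeas_cst.
by under eq_fun do rewrite big_cons; exact: cbmeasD.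
Qed.

Lemma cbmeas_real f : rbmeas f -> cbmeas (fun u => (f u)%:C).
Proof.
move=> [mf [K fK]]; split; first exact: cmeasurable_real.
exists K%:C => u uU; rewrite norm_realc lecR.
exact: fK.
Qed.

Lemma cbmeas_entry i j : cbmeas (fun u => u i j).
Proof.
split; first exact: cmeasurable_entry.
exists 1 => u /unitary_conjP/(_ i i); rewrite eqxx/= => ui1.
have : `|u i j| ^+ 2 <= 1.
  rewrite -[X in _ <= X]ui1 (bigD1 j)//= -sqr_normc lerDl.
  by apply: sumr_ge0 => k _; exact: mulcJ_ge0.
by rewrite expr_le1.
Qed.

Definition cE phi : C := rE (fun u => Re (phi u)) +i* rE (fun u => Im (phi u)).

Lemma eq_cE phi psi : (forall u, u \is unitarymx -> phi u = psi u) ->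
  cE phi = cE psi.
Proof. by move=> e; congr Complex; apply: eq_rE => u /e ->. Qed.

Lemma cE_cst (k : C) : cE (fun=> k) = k.
Proof. by rewrite /cE !rE_cst; case: k. Qed.

Lemma cED phi psi : cbmeas phi -> cbmeas psi ->
  cE (fun u => phi u + psi u) = cE phi + cE psi.
Proof.
move=> nphi npsi; rewrite /cE; simpc; congr Complex.
- under eq_rE do rewrite complex_ReD.
  by rewrite rED//; exact: cbmeas_Re.
- under eq_rE do rewrite complex_ImD.
  by rewrite rED//; exact: cbmeas_Im.
Qed.

Lemma cEZ (k : C) phi : cbmeas phi -> cE (fun u => k * phi u) = k * cE phi.
Proof.
move=> nphi; have nR := cbmeas_Re _ nphi; have nI := cbmeas_Im _ nphi.
have -> : cE (fun u => k * phi u) =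
    (Re k * rE (fun u => Re (phi u)) + - Im k * rE (fun u => Im (phi u))) +i*
    (Re k * rE (fun u => Im (phi u)) + Im k * rE (fun u => Re (phi u))).
  rewrite -!rEZ// -!rED; try exact: rbmeasZ.
  congr Complex; apply: eq_rE => u _; first by rewrite complex_ReM mulNr.
  exact: complex_ImM.
by rewrite /cE; case: k => a b /=; simpc.
Qed.

Lemma cE_sum (I : Type) (r : seq I) (F : I -> M -> C) :
  (forall i, cbmeas (F i)) ->
  cE (fun u => \sum_(i <- r) F i u) = \sum_(i <- r) cE (F i).
Proof.
move=> nF; elim: r => [|i r IHr].
  by under eq_cE do rewrite big_nil; rewrite cE_cst big_nil.
under eq_cE do rewrite big_cons.
by rewrite big_cons cED ?IHr//; exact: cbmeas_sum.
Qed.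

Lemma cE_mulmx v phi : v \is unitarymx -> cbmeas phi ->
  cE (fun u => phi (v *m u)) = cE phi.
Proof.
move=> vU nphi; rewrite /cE (rE_mulmx _ (fun u => Re (phi u)))//.
  by rewrite (rE_mulmx _ (fun u => Im (phi u)))//; exact: cbmeas_Im.
exact: cbmeas_Re.
Qed.

Lemma cbmeas_mulmx v phi : v \is unitarymx -> cbmeas phi ->
  cbmeas (fun u => phi (v *m u)).
Proof.
move=> vU nphi; have [_ [K phiK]] := nphi; split; last first.
  by exists K => u uU; apply: phiK; rewrite unitary_mul.
split.
- by have [] := rbmeas_mulmx _ _ vU (cbmeas_Re _ nphi).
- by have [] := rbmeas_mulmx _ _ vU (cbmeas_Im _ nphi).
Qed.

(** The factor 2 comes from bounding real and imaginary parts separately; it is harmless because the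
    bound is applied to O(t^2) remainders. *)
Lemma cE_norm_le phi (K : C) : cbmeas phi ->
  (forall u, u \is unitarymx -> `|phi u| <= K) -> `|cE phi| <= 2 * K.
Proof.
move=> nphi phiK.
have K0 : 0 <= K.
  have /phiK : 1%:M \is @unitarymx C n n.
    by apply/unitarymxP; rewrite trmx1 map_mx1 mulmx1.
  exact: le_trans.
have KE : (Re K)%:C = K by rewrite RRe_real// ger0_real.
have RK : `|rE (fun u => Re (phi u))| <= Re K.
  apply: rE_norm_le; first exact: cbmeas_Re.
  by move=> u /phiK/(le_trans (normc_ge_Re _)); rewrite lecE => /andP[].
have IK : `|rE (fun u => Im (phi u))| <= Re K.
  apply: rE_norm_le; first exact: cbmeas_Im.
  by move=> u /phiK/(le_trans (normc_ge_Im _)); rewrite lecE => /andP[].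
rewrite /cE [X in `|X|]complexE/= (le_trans (ler_normD _ _))// mulr_natl mulr2n.
by rewrite -KE lerD// ?normrM ?norm_ic ?mul1r norm_realc lecR.
Qed.

End expectation.

(** * Integration by parts on the unitary group *)

Section derivation.
Context {R : realType} {n : nat} (mu : probability (borel_mx R n) R).
Context (haar_mu : haar_unitary mu).
Notation C := R[i].
Notation M := 'M[C]_n.
Implicit Types (u v : M) (f g : M -> R) (phi psi : M -> C) (t : R).
Implicit Types (a : 'I_n -> C) (D E : 'I_n -> 'I_n -> M -> C).

Lemma sum_delta (b : 'I_n -> C) l : \sum_k (l == k)%:R * b k = b l.
Proof.
rewrite (bigD1 l)//= eqxx mul1r big1 ?addr0// => k kl.
by rewrite eq_sym (negbTE kl) mul0r.
Qed.

(** * Unitary curves from the Cayley transform *)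

Definition rank1 a : M := \matrix_(j, k) (a j * conjc (a k)).

Definition sqnorm a : R := \sum_k Re (a k * conjc (a k)).

Lemma sqnorm_ge0 a : 0 <= sqnorm a.
Proof.
by apply: sumr_ge0 => k _; have := mulcJ_ge0 (a k); rewrite lecE => /andP[].
Qed.

Lemma sqnormE a : (sqnorm a)%:C = \sum_k a k * conjc (a k).
Proof.
rewrite rmorph_sum; apply: eq_bigr => k _.
by rewrite -[LHS]/((Re (a k * conjc (a k)))%:C) RRe_real// ger0_real// mulcJ_ge0.
Qed.

(** The part of [cayley a t] linear in t: (1 + X) / (1 - X) begins with 1 + 2 X, here with X = i t
    [rank1 a]. *)
Definition tau t : C := 2 * 'i%C * t%:C.

Lemma tau_conj t : conjc (tau t) = - tau t.
Proof. by rewrite /tau !conjcM (conjc_nat _ 2) conj_ic conjc_real mulrN mulNr. Qed.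

Definition cayley a t : C := tau t / (1 - 'i%C * (sqnorm a * t)%:C).

(* As rank1 a has square (sqnorm a) *: rank1 a, this is the Cayley transform
   of i t rank1 a. *)
Definition rotation a t : M := 1%:M + cayley a t *: rank1 a.

Lemma cayley_den_norm (x : R) : 1 <= `|1 - 'i%C * x%:C|.
Proof.
apply: le_trans (normc_ge_Re _).
have -> : Re (1 - 'i%C * x%:C) = 1 by rewrite complex_ReB complex_ReM /=; ring.
by rewrite normr1.
Qed.

Lemma cayley_den_neq0 (x : R) : 1 - 'i%C * x%:C != 0.
Proof. by rewrite -normr_gt0 (lt_le_trans _ (cayley_den_norm x)). Qed.

(** This is the unitarity condition for 1 + w a a^*: in its product with its adjoint, the
    coefficient of a a^* is w + conj w + |w|^2 [sqnorm a]. *)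
Lemma cayley_conj a t :
  cayley a t + conjc (cayley a t)
    + cayley a t * conjc (cayley a t) * (sqnorm a)%:C = 0.
Proof.
have d0 := cayley_den_neq0 (sqnorm a * t).
have d1 : 1 + 'i%C * (sqnorm a * t)%:C != 0.
  by have := cayley_den_neq0 (- (sqnorm a * t)); rewrite rmorphN mulrN opprK.
have denJ (x : R) : conjc (1 - 'i%C * x%:C) = 1 + 'i%C * x%:C.
  by rewrite conjcB conjcM conjc1 conj_ic conjc_real mulNr opprK.
have -> : conjc (cayley a t) = - tau t / (1 + 'i%C * (sqnorm a * t)%:C).
  by rewrite /cayley -denJ -tau_conj -conjc_inv -conjcM.
rewrite /cayley /tau; rewrite rmorphM/= in d0 d1 *.
have i2 : 'i%C * 'i%C = -1 :> C by rewrite -expr2 sqr_i.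
by field: i2; apply/andP.
Qed.

Lemma rotation_unitary a t : rotation a t \is unitarymx.
Proof.
apply/unitary_conjP => i j; rewrite /rotation.
move: (cayley a t) (cayley_conj a t) => w wJ.
transitivity (\sum_k ((i == k)%:R * (j == k)%:R
    + w * a i * ((j == k)%:R * conjc (a k))
    + conjc w * conjc (a j) * ((i == k)%:R * a k)
    + w * conjc w * a i * conjc (a j) * (a k * conjc (a k)))).
  apply: eq_bigr => k _; rewrite !mxE conjcD !conjcM conjcK (conjc_nat _ (j == k)).
  by ring.
rewrite !big_split/= -!mulr_sumr !sum_delta -sqnormE (eq_sym j).
transitivity ((i == j)%:R +
    (w + conjc w + w * conjc w * (sqnorm a)%:C) * (a i * conjc (a j))).
  by ring.
by rewrite wJ mul0r addr0.
Qed.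

Lemma cayley_tau a t : 0 <= t ->
  `|cayley a t - tau t| <= 2 * (sqnorm a)%:C * t%:C ^+ 2.
Proof.
move=> t0; have d0 := cayley_den_neq0 (sqnorm a * t).
have d1 := cayley_den_norm (sqnorm a * t).
have -> : cayley a t - tau t =
    'i%C ^+ 2 * (2 * (sqnorm a)%:C * t%:C ^+ 2) / (1 - 'i%C * (sqnorm a * t)%:C).
  by rewrite /cayley /tau rmorphM/= in d0 *; field.
have c0 := sqnorm_ge0 a.
have e0 : 0 <= 2 * (sqnorm a)%:C * t%:C ^+ 2 :> C.
  by rewrite mulr_ge0 ?exprn_ge0 ?mulr_ge0 ?ler0c.
rewrite normrM normrM normrX norm_ic expr1n mul1r normfV ger0_norm//.
by rewrite ler_pdivrMr ?(lt_le_trans _ d1)// ler_peMr.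
Qed.

Lemma tau_norm t : 0 <= t -> `|tau t| = 2 * t%:C.
Proof.
by move=> t0; rewrite /tau !normrM norm_ic mulr1 norm_realc !ger0_norm.
Qed.

Definition dirder D a u : C := \sum_j \sum_k a j * conjc (a k) * D j k u.

(* D j k is the derivative of phi along the elementary matrix (j, k); a general
   direction Z gives \sum_(j, k) Z j k * D j k, but only skew-hermitian matrices,
   such as 'i *: rank1 a, are tangent to the unitary group. *)
Definition isDer phi D := [/\ cbmeas phi, (forall j k, cbmeas (D j k)) &
  forall a, exists K, forall u t, u \is unitarymx -> 0 < t < 1 ->
    `|phi (rotation a t *m u) - phi u - tau t * dirder D a u| <= K * t%:C ^+ 2].

(** * Rules of differentiation *)

Lemma isDer_cst (k : C) : isDer (fun=> k) (fun _ _ _ => 0).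
Proof.
split=> [|_ _|a]; [exact: cbmeas_cst|exact: cbmeas_cst|exists 0 => u t _ _].
rewrite /dirder big1 => [|i _]; last by rewrite big1// => j _; rewrite mulr0.
by rewrite subrr mulr0 subrr normr0 mul0r.
Qed.

Lemma isDer_entry l m : isDer (fun u => u l m) (fun j k u => (j == l)%:R * u k m).
Proof.
split=> [|j k|a].
- exact: cbmeas_entry.
- by apply: cbmeasM; [exact: cbmeas_cst|exact: cbmeas_entry].
have [_ [K entryK]] : cbmeas (fun u => (rank1 a *m u) l m).
  under eq_fun do rewrite !mxE.
  by apply: cbmeas_sum => i; apply: cbmeasM; [exact: cbmeas_cst|exact: cbmeas_entry].
exists (2 * (sqnorm a)%:C * K) => u t uU /andP[t0 _].
have -> : dirder (fun j k v => (j == l)%:R * v k m) a u = (rank1 a *m u) l m.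
  rewrite /dirder mxE (bigD1 l)//= [X in _ + X]big1 ?addr0 => [|j jl].
    by apply: eq_bigr => k _; rewrite !mxE eqxx mul1r.
  by rewrite big1// => k _; rewrite (negbTE jl) mul0r mulr0.
rewrite /rotation mulmxDl mul1mx mxE [u l m + _]addrC addrK -scalemxAl mxE -mulrBl.
rewrite normrM mulrAC ler_pM//; first exact/cayley_tau/ltW.
exact: entryK.
Qed.

Lemma cbmeasN phi : cbmeas phi -> cbmeas (fun u => - phi u).
Proof.
move=> nphi; have -> : (fun u => - phi u) = (fun u => -1 * phi u).
  by apply/funext => u; rewrite mulN1r.
by apply: cbmeasM => //; exact: cbmeas_cst.
Qed.

Lemma dirder_cbmeas D a : (forall j k, cbmeas (D j k)) -> cbmeas (dirder D a).
Proof.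
move=> nD; apply: cbmeas_sum => j; apply: cbmeas_sum => k.
by apply: cbmeasM => //; exact: cbmeas_cst.
Qed.

Lemma isDerD phi psi D E : isDer phi D -> isDer psi E ->
  isDer (fun u => phi u + psi u) (fun j k u => D j k u + E j k u).
Proof.
move=> [nphi nD hphi] [npsi nE hpsi]; split=> [|j k|a]; [exact: cbmeasD..|].
have [K hK] := hphi a; have [L hL] := hpsi a.
exists (K + L) => u t uU t01; rewrite mulrDl.
apply: le_trans (lerD (hK u t uU t01) (hL u t uU t01)).
apply: le_trans (ler_normD _ _); rewrite le_eqVlt; apply/orP; left; apply/eqP.
congr `|_|; have -> : dirder (fun j k v => D j k v + E j k v) a u =
    dirder D a u + dirder E a u.
  rewrite /dirder -big_split; apply: eq_bigr => j _ /=.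
  by rewrite -big_split; apply: eq_bigr => k _ /=; rewrite mulrDr.
by ring.
Qed.

Lemma isDer_sum (I : Type) (r : seq I) (F : I -> M -> C) (D : I -> _) :
  (forall i, isDer (F i) (D i)) ->
  isDer (fun u => \sum_(i <- r) F i u) (fun j k u => \sum_(i <- r) D i j k u).
Proof.
move=> hF; elim: r => [|i r IHr].
  rewrite [X in isDer X](_ : _ = fun=> 0); last by apply/funext => u; rewrite big_nil.
  rewrite [X in isDer _ X](_ : _ = fun _ _ _ => 0); first exact: isDer_cst.
  by apply/funext => j; apply/funext => k; apply/funext => u; rewrite big_nil.
rewrite [X in isDer X](_ : _ = fun u => F i u + \sum_(i <- r) F i u); last first.
  by apply/funext => u; rewrite big_cons.
rewrite [X in isDer _ X](_ : _ = fun j k u => D i j k u + \sum_(i <- r) D i j k u).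
  exact: isDerD.
by apply/funext => j; apply/funext => k; apply/funext => u; rewrite big_cons.
Qed.

(** Increments are O(t), so products of two of them go into the O(t^2) remainder of the product and
    chain rules. *)
Lemma isDer_incr phi D a : isDer phi D -> exists K, forall u t,
  u \is unitarymx -> 0 < t < 1 -> `|phi (rotation a t *m u) - phi u| <= K * t%:C.
Proof.
move=> [_ nD /(_ a)[K hK]]; have [_ [L hL]] := dirder_cbmeas _ a nD.
exists (2 * L + K) => u t uU t01; have /andP[t0 t1] := t01.
rewrite -[X in `|X|](subrK (tau t * dirder D a u)) addrC mulrDl.
rewrite (le_trans (ler_normD _ _))// lerD//.
  rewrite normrM tau_norm ?(ltW t0)// mulrAC ler_wpM2r ?ler0c ?(ltW t0)//.
  by rewrite ler_wpM2l ?hL.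
have K0 : 0 <= K.
  have := le_trans (normr_ge0 _) (hK u t uU t01).
  by rewrite pmulr_lge0// exprn_gt0// (ltcR 0).
rewrite (le_trans (hK u t uU t01))// ler_wpM2l// expr2 ler_piMr ?ler0c ?(ltW t0)//.
by rewrite -[1]/(1%:C) lecR ltW.
Qed.

Lemma isDerM phi psi D E : isDer phi D -> isDer psi E ->
  isDer (fun u => phi u * psi u) (fun j k u => D j k u * psi u + phi u * E j k u).
Proof.
move=> hphi hpsi; have [nphi nD dphi] := hphi; have [npsi nE dpsi] := hpsi.
split=> [|j k|a]; [exact: cbmeasM|by apply: cbmeasD; exact: cbmeasM|].
have [K hK] := dphi a; have [L hL] := dpsi a.
have [K' hK'] := isDer_incr _ _ a hphi; have [L' hL'] := isDer_incr _ _ a hpsi.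
have [_ [P hP]] := nphi; have [_ [Q hQ]] := npsi.
exists (K * Q + P * L + K' * L') => u t uU t01.
have -> : dirder (fun j k v => D j k v * psi v + phi v * E j k v) a u =
    dirder D a u * psi u + phi u * dirder E a u.
  rewrite /dirder mulr_suml mulr_sumr -big_split; apply: eq_bigr => j _ /=.
  by rewrite mulr_suml mulr_sumr -big_split; apply: eq_bigr => k _ /=; ring.
have := hK u t uU t01; have := hL u t uU t01.
have := hK' u t uU t01; have := hL' u t uU t01; have := hP u uU; have := hQ u uU.
move: (phi u) (psi u) (phi (_ *m u)) (psi (_ *m u)) (dirder D a u) (dirder E a u).
move=> x y x' y' dx dy hy hx hy' hx' ry rx.
have -> : x' * y' - x * y - tau t * (dx * y + x * dy) =
  (x' - x - tau t * dx) * y + x * (y' - y - tau t * dy) + (x' - x) * (y' - y).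
  by ring.
rewrite [leRHS]mulrDl [X in _ <= X + _]mulrDl (le_trans (ler_normD _ _))// lerD//.
  rewrite (le_trans (ler_normD _ _))// lerD// normrM.
    by rewrite [leRHS]mulrAC ler_pM.
  by rewrite -[leRHS]mulrA ler_pM.
by rewrite normrM expr2 [leRHS]mulrACA ler_pM.
Qed.

(** The sign appears because [tau t] is purely imaginary, and the indices are swapped because
    conjugating a_j conj a_k exchanges j and k. *)
Lemma isDer_conj phi D : isDer phi D ->
  isDer (fun u => conjc (phi u)) (fun j k u => - conjc (D k j u)).
Proof.
move=> [nphi nD dphi]; split=> [|j k|a].
- exact: cbmeas_conj.
- by apply: cbmeasN; exact: cbmeas_conj.
have [K hK] := dphi a; exists K => u t uU t01.
have -> : dirder (fun j k v => - conjc (D k j v)) a u = - conjc (dirder D a u).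
  rewrite /dirder exchange_big conjc_sum -sumrN; apply: eq_bigr => j _ /=.
  rewrite conjc_sum -sumrN; apply: eq_bigr => k _ /=.
  by rewrite !conjcM conjcK mulrN; congr (- (_ * _)); rewrite mulrC.
rewrite mulrN -mulNr -tau_conj -conjcM -!conjcB normcJ.
exact: hK.
Qed.

Lemma taylor_lipschitz (F dF : R -> R) (B L : R) x y :
  (forall z : R, is_derive z 1 F (dF z)) ->
  (forall z w, `|z| <= B -> `|w| <= B -> `|dF z - dF w| <= L * `|z - w|) ->
  `|x| <= B -> `|y| <= B ->
  `|F y - F x - dF x * (y - x)| <= `|L| * `|y - x| ^+ 2.
Proof.
move=> dFF dFL xB yB.
have [z [zB zx ->]] : exists z, [/\ `|z| <= B, `|z - x| <= `|y - x| &
    F y - F x = dF z * (y - x)].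
  have cF S : {within S, continuous F}.
    by apply: continuous_subspaceT; exact: is_derive_continuous dFF.
  move: xB yB; rewrite !ler_norml => /andP[xB1 xB2] /andP[yB1 yB2].
  have [xy|yx] := leP x y.
    have [|z] := @MVT_segment R F dF x y xy (fun z _ => dFF z); first exact: cF.
    rewrite in_itv/= => /andP[xz zy] zE; exists z; split=> //.
      by rewrite ler_norml; lra.
    by rewrite !ger0_norm; lra.
  have [|z] := @MVT_segment R F dF y x (ltW yx) (fun z _ => dFF z); first exact: cF.
  rewrite in_itv/= => /andP[yz zx] zE; exists z; split.
  - by rewrite ler_norml; lra.
  - by rewrite !ler0_norm; lra.
  - by rewrite -opprB zE; ring.
rewrite -mulrBl normrM expr2 mulrA ler_wpM2r// (le_trans (dFL _ _ zB xB))//.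
apply: (@le_trans _ _ (`|L| * `|z - x|)); first by rewrite ler_wpM2r// ler_norm.
by rewrite ler_wpM2l.
Qed.

Lemma isDer_comp (X : M -> R) D (F dF : R -> R) :
  isDer (fun u => (X u)%:C) D -> stein_test F dF ->
  isDer (fun u => (F (X u))%:C) (fun j k u => (dF (X u))%:C * D j k u).
Proof.
move=> hX [dFF cdF dF2 dFL]; have [nX nD dX] := hX.
have rX : rbmeas X := cbmeas_Re _ nX; have [mX [B XB]] := rX.
have [L hL] := dFL B.
have ndF : cbmeas (fun u => (dF (X u))%:C).
  exact: cbmeas_real (rbmeas_comp _ _ _ cdF dF2 rX).
split=> [|j k|a]; [|exact: cbmeasM|].
  apply: cbmeas_real; split.
    have cF := is_derive_continuous _ _ dFF.
    exact: (measurableT_comp (continuous_measurable_fun cF) mX).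
  exists (`|F 0| + 2 * B) => u uU; rewrite -[F _](subrK (F 0)) addrC.
  rewrite (le_trans (ler_normD _ _))// lerD//.
  rewrite (le_trans (is_derive_lipschitz _ _ _ _ _ dFF dF2))// subr0.
  by rewrite ler_wpM2l// XB.
have [K hK] := dX a; have [K' hK'] := isDer_incr _ _ a hX.
exists (`|L|%:C * K' ^+ 2 + 2 * K) => u t uU t01.
have -> : dirder (fun j k v => (dF (X v))%:C * D j k v) a u =
    (dF (X u))%:C * dirder D a u.
  rewrite /dirder mulr_sumr; apply: eq_bigr => j _ /=.
  by rewrite mulr_sumr; apply: eq_bigr => k _ /=; rewrite mulrCA.
set u' := rotation a t *m u.
have u'U : u' \is unitarymx.
  by rewrite (unitary_mul _ _ (rotation_unitary a t)); exact: uU.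
(* The first term is the Taylor remainder of F, quadratic in an O(t) increment of [X]; the second is
   the remainder of [X] multiplied by [dF], which is at most 2 in absolute value. *)
have -> : (F (X u'))%:C - (F (X u))%:C - tau t * ((dF (X u))%:C * dirder D a u) =
    (F (X u') - F (X u) - dF (X u) * (X u' - X u))%:C +
    (dF (X u))%:C * ((X u')%:C - (X u)%:C - tau t * dirder D a u).
  by rewrite !rmorphB/= rmorphM/= rmorphB/=; ring.
rewrite mulrDl (le_trans (ler_normD _ _))// lerD//.
  have tay := taylor_lipschitz _ _ _ _ _ _ dFF hL (XB u uU) (XB u' u'U).
  rewrite norm_realc (@le_trans _ _ (`|L| * `|X u' - X u| ^+ 2)%:C) ?lecR//.
  rewrite rmorphM rmorphXn/= -mulrA -exprMn ler_wpM2l ?ler0c//.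
  have := hK' u t uU t01; rewrite -/u' -rmorphB norm_realc => h.
  by rewrite ler_pXn2r// ?nnegrE ?ler0c// (le_trans _ h)// ler0c.
rewrite normrM -mulrA ler_pM//; last exact: hK.
have -> : (2 : C) = (2 : R)%:C by rewrite rmorph_nat.
by rewrite norm_realc lecR; exact: dF2.
Qed.

(* Polarization: a = x e_j + y e_k with (x, y) = (1, 0), (0, 1), (1, 1), (1, i). *)
Lemma sesquilinear_eq0 (B : 'I_n -> 'I_n -> C) :
  (forall a, \sum_j \sum_k a j * conjc (a k) * B j k = 0) -> forall j k, B j k = 0.
Proof.
move=> B0 j k; pose a (x y : C) i : C := (j == i)%:R * x + (k == i)%:R * y.
have aE x y : x * conjc x * B j j + x * conjc y * B j k + y * conjc x * B k j +
    y * conjc y * B k k = 0.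
  rewrite -(B0 (a x y)).
  have inner i : \sum_l a x y i * conjc (a x y l) * B i l =
      (j == i)%:R * (x * (conjc x * B i j + conjc y * B i k)) +
      (k == i)%:R * (y * (conjc x * B i j + conjc y * B i k)).
    transitivity (\sum_l ((j == l)%:R * (a x y i * conjc x * B i l) +
                         (k == l)%:R * (a x y i * conjc y * B i l))).
      apply: eq_bigr => l _; rewrite /a conjcD !conjcM !conjc_nat; ring.
    by rewrite big_split/= !sum_delta /a; ring.
  by under eq_bigr do rewrite inner; rewrite big_split/= !sum_delta; ring.
have Bjj : B j j = 0.
  by have := aE 1 0; rewrite !conjc0 conjc1 !mulr0 !mul0r !addr0 !mul1r.
have Bkk : B k k = 0.
  by have := aE 0 1; rewrite !conjc0 conjc1 !mulr0 !mul0r !add0r !mul1r.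
have := aE 1 1; have := aE 1 'i%C.
rewrite Bjj Bkk conjc1 conj_ic !mulr0 !mul1r !add0r !addr0 mulr1 => h1 h2.
have i0 : 'i%C != 0 :> C by rewrite -normr_gt0 norm_ic.
have /eqP : 'i%C * (B j k + B j k) = 0.
  transitivity ('i%C * (B j k + B k j) - (- 'i%C * B j k + 'i%C * B k j)).
    by ring.
  by rewrite h1 h2 mulr0 subr0.
by rewrite mulf_eq0 (negbTE i0)/= -mulr2n mulrn_eq0/= => /eqP.
Qed.

Lemma le_small_eq0 (s K : R) : 0 <= s ->
  (forall t, 0 < t < 1 -> s <= K * t) -> s = 0.
Proof.
move=> s0 sK; apply/eqP; rewrite eq_le s0 andbT leNgt; apply/negP => {}s0.
have d0 : 0 < 2 * (`|K| + s) by rewrite mulr_gt0// ltr_wpDl.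
have /sK : 0 < s / (2 * (`|K| + s)) < 1.
  by rewrite divr_gt0//= ltr_pdivrMr// mul1r; have := normr_ge0 K; lra.
rewrite mulrA ler_pdivlMr// leNgt => /negP; apply.
have := ler_norm K; have := normr_ge0 K; nra.
Qed.

(** By invariance phi has the same mean at [rotation a t *m u] and at u, so [tau t] times the mean
    of [dirder D a] is O(t^2). Dividing by t and letting t tend to 0 shows that this mean vanishes
    for every a, and polarization separates the pairs (j, k). *)
Lemma cE_isDer phi D j k : isDer phi D -> cE mu (D j k) = 0.
Proof.
move=> [nphi nD dphi]; move: j k; apply: sesquilinear_eq0 => a.
have ndir := dirder_cbmeas _ a nD.
have -> : \sum_j \sum_k a j * conjc (a k) * cE mu (D j k) = cE mu (dirder D a).
  have nt j k : cbmeas (fun u => a j * conjc (a k) * D j k u).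
    by apply: cbmeasM => //; exact: cbmeas_cst.
  rewrite cE_sum// => [|j]; last exact: cbmeas_sum.
  by apply: eq_bigr => j _; rewrite cE_sum//; apply: eq_bigr => k _; rewrite cEZ.
have [K hK] := dphi a; set S := cE _ _.
apply/normr0_eq0; rewrite -(RRe_real (normr_real S)).
suff -> : Re `|S| = 0 by [].
apply: (@le_small_eq0 _ (Re K)).
  by have := normr_ge0 S; rewrite lecE => /andP[].
move=> t t01; have /andP[t0 t1] := t01.
have tc0 : 0 < t%:C :> C by rewrite (ltcR 0).
have rotU := rotation_unitary a t.
have nrot := cbmeas_mulmx _ _ rotU nphi.
pose r u := phi (rotation a t *m u) + (-1 * phi u + - tau t * dirder D a u).
have nZ (k : C) psi : cbmeas psi -> cbmeas (fun u => k * psi u).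
  by move=> npsi; apply: cbmeasM => //; exact: cbmeas_cst.
have nr : cbmeas r by apply: cbmeasD => //; apply: cbmeasD; exact: nZ.
have Er : cE mu r = - tau t * S.
  rewrite cED//; last by apply: cbmeasD; exact: nZ.
  rewrite cED ?cEZ//; try exact: nZ.
  by rewrite (cE_mulmx mu haar_mu _ _ rotU nphi) mulN1r addrA subrr add0r.
have : `|cE mu r| <= 2 * (K * t%:C ^+ 2).
  apply: (cE_norm_le mu haar_mu _ _ nr) => u uU.
  by have := hK u t uU t01; rewrite /r mulN1r mulNr addrA.
rewrite Er normrM normrN tau_norm ?(ltW t0)// -!mulrA ler_pM2l//.
move=> le_tS; have {le_tS}h : `|S| <= K * t%:C.
  by rewrite -(ler_pM2l tc0) (le_trans le_tS)// expr2 mulrCA.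
have := h; rewrite lecE complex_ReM /= mulr0 subr0 => /andP[_].
exact.
Qed.

End derivation.

(** * Moments of the circular orthogonal ensemble *)

Section coe.
Context {R : realType} {n : nat} (mu : probability (borel_mx R n) R).
Context (haar_mu : haar_unitary mu).
Notation C := R[i].
Notation M := 'M[C]_n.
Implicit Types (u v : M).

Lemma isDer_ext (phi psi : M -> C) D E : phi =1 psi ->
  (forall j k u, D j k u = E j k u) -> isDer phi D -> isDer psi E.
Proof.
move=> /funext -> DE; rewrite (_ : D = E)//.
by apply/funext => j; apply/funext => k; apply/funext => u.
Qed.

Lemma isDer_cbmeas (phi : M -> C) D : isDer phi D -> cbmeas phi.
Proof. by case. Qed.

(** Integration by parts as it is applied below: component (j, k) of a field is differentiated in
    direction (j, k), so each use costs one divergence computation. *)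
Lemma divergence_eq0 (F : 'I_n -> 'I_n -> M -> C) D :
  (forall j k, isDer (F j k) (D j k)) ->
  cE mu (fun u => \sum_j \sum_k D j k j k u) = 0.
Proof.
move=> FD; have nD j k : cbmeas (D j k j k) by case: (FD j k).
rewrite cE_sum// => [|j]; last exact: cbmeas_sum.
rewrite big1// => j _; rewrite cE_sum// big1// => k _.
exact: (cE_isDer mu haar_mu _ _ j k (FD j k)).
Qed.

(** * Power sums and their derivatives *)

Definition coe u : M := u *m u^T.
Definition coe2 u : M := coe u *m coe u.
Definition p1 u : C := \tr (coe u).
Definition p2 u : C := \tr (coe2 u).

Lemma coe_sym u i j : coe u i j = coe u j i.
Proof. by rewrite !mxE; apply: eq_bigr => k _; rewrite !mxE mulrC. Qed.

Lemma coe2_sym u i j : coe2 u i j = coe2 u j i.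
Proof.
by rewrite !mxE; apply: eq_bigr => k _; rewrite (coe_sym u i k) (coe_sym u k j) mulrC.
Qed.

Lemma coe_unitary u : u \is unitarymx -> coe u \is unitarymx.
Proof.
by move=> uU; rewrite /coe (unitary_mul _ _ uU) trmx_unitary; exact: uU.
Qed.

Lemma unitary_sumsq u : u \is unitarymx ->
  \sum_j \sum_k u j k * conjc (u j k) = n%:R.
Proof.
move=> /unitary_conjP uU; under eq_bigr do rewrite uU eqxx.
by rewrite sumr_const card_ord.
Qed.

Lemma sum_coe_sq u : \sum_j \sum_k coe u j k * coe u j k = p2 u.
Proof.
apply: eq_bigr => j _; rewrite [RHS]mxE; apply: eq_bigr => k _.
by rewrite [X in _ = _ * X]coe_sym.
Qed.

(** With h the adjoint of g, the sum is tr (g h h), and g h = 1 leaves tr h. *)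
Lemma sum_coe_coe2 u : u \is unitarymx ->
  \sum_j \sum_k coe u j k * conjc (coe2 u j k) = conjc (p1 u).
Proof.
move=> /coe_unitary/unitary_conjP uU; rewrite /p1 conjc_sum; apply: eq_bigr => j _.
transitivity (\sum_l conjc (coe u j l) * \sum_k coe u j k * conjc (coe u l k)).
  under [RHS]eq_bigr do rewrite mulr_sumr; rewrite exchange_big/=.
  apply: eq_bigr => k _; rewrite [coe2 u j k]mxE conjc_sum mulr_sumr.
  by apply: eq_bigr => l _; rewrite conjcM; ring.
under eq_bigr do rewrite uU mulrC.
exact: sum_delta.
Qed.

(** Entry (l, m) of E_jk g + g E_jk^T, the derivative of u u^T when u moves along E_jk u. *)
Lemma isDer_coe l m : isDer (fun u => coe u l m)
  (fun j k u => (j == l)%:R * coe u k m + (j == m)%:R * coe u l k).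
Proof.
have h := isDer_sum _ (index_enum 'I_n) _ _
  (fun r => isDerM _ _ _ _ (@isDer_entry R n l r) (@isDer_entry R n m r)).
apply: isDer_ext h => [u|j k u].
  by rewrite mxE; apply: eq_bigr => r _; rewrite mxE.
rewrite [coe u k m]mxE [coe u l k]mxE !mulr_sumr -big_split; apply: eq_bigr => r _ /=.
by rewrite !mxE; ring.
Qed.

Lemma isDer_coe2 l m : isDer (fun u => coe2 u l m)
  (fun j k u => (j == l)%:R * coe2 u k m + coe u l k * coe u j m
    + coe u l j * coe u k m + (j == m)%:R * coe2 u l k).
Proof.
have h := isDer_sum _ (index_enum 'I_n) _ _
  (fun r => isDerM _ _ _ _ (isDer_coe l r) (isDer_coe r m)).
apply: isDer_ext h => [u|j k u]; first by rewrite mxE.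
transitivity (\sum_r ((j == l)%:R * (coe u k r * coe u r m)
   + (j == r)%:R * (coe u l k * coe u r m) + (j == r)%:R * (coe u l r * coe u k m)
   + (j == m)%:R * (coe u l r * coe u r k))).
  by apply: eq_bigr => r _; ring.
by rewrite !big_split/= !sum_delta -!mulr_sumr [coe2 u k m]mxE [coe2 u l k]mxE.
Qed.

Lemma isDer_p1 : isDer p1 (fun j k u => 2 * coe u j k).
Proof.
have h := isDer_sum _ (index_enum 'I_n) _ _ (fun l => isDer_coe l l).
apply: isDer_ext h => // j k u.
by rewrite big_split/= !sum_delta (coe_sym u k); ring.
Qed.

Lemma isDer_p2 : isDer p2 (fun j k u => 4 * coe2 u j k).
Proof.
have h := isDer_sum _ (index_enum 'I_n) _ _ (fun l => isDer_coe2 l l).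
apply: isDer_ext h => // j k u.
have e1 : \sum_l coe u l k * coe u j l = coe2 u j k.
  by rewrite mxE; apply: eq_bigr => l _; rewrite mulrC.
have e2 : \sum_l coe u l j * coe u k l = coe2 u j k.
  by rewrite mxE; apply: eq_bigr => l _; rewrite (coe_sym u l j) (coe_sym u k l).
by rewrite !big_split/= !sum_delta e1 e2 (coe2_sym u k); ring.
Qed.

(** The divergence of the field g_jk; [j == j] stays unreduced to match the instance of [isDer_coe]
    at l = j, m = k. *)
Lemma sum_div_coe u :
  \sum_j \sum_k ((j == j)%:R * coe u k k + (j == k)%:R * coe u j k)
  = (n%:R + 1) * p1 u.
Proof.
transitivity (\sum_(j < n) (p1 u + coe u j j)).
  apply: eq_bigr => j _; rewrite big_split/= sum_delta; congr (_ + _).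
  by apply: eq_bigr => k _; rewrite eqxx mul1r.
by rewrite big_split/= sumr_const card_ord mulrDl mul1r mulr_natl.
Qed.

Lemma sum_div_coe2 u :
  \sum_j \sum_k ((j == j)%:R * coe2 u k k + coe u j k * coe u j k
    + coe u j j * coe u k k + (j == k)%:R * coe2 u j k)
  = (n%:R + 2) * p2 u + p1 u * p1 u.
Proof.
transitivity (\sum_(j < n) (p2 u + \sum_k coe u j k * coe u j k
    + coe u j j * p1 u + coe2 u j j)).
  apply: eq_bigr => j _; rewrite !big_split/= sum_delta -!mulr_sumr.
  by rewrite eqxx mul1r.
rewrite !big_split/= sum_coe_sq sumr_const card_ord -mulr_suml -mulr_natl.
by rewrite -[\sum_j coe2 u j j]/(p2 u) -[\sum_j coe u j j]/(p1 u); ring.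
Qed.

Let A := cE mu (fun u => p2 u * conjc (p2 u)).
Let B := cE mu (fun u => p1 u * p1 u * conjc (p2 u)).
Let C11 := cE mu (fun u => p1 u * conjc (p1 u)).

Lemma cbmeas_p1 : cbmeas p1. Proof. exact: isDer_cbmeas isDer_p1. Qed.
Lemma cbmeas_p2 : cbmeas p2. Proof. exact: isDer_cbmeas isDer_p2. Qed.

(** By [isDer_conj], differentiating conj p_2 contributes -4 times the sum of |(g^2)_jk|^2, which is
    n because g^2 is unitary. *)
Lemma moment_p2 : (n%:R + 2) * A + B = 4 * n%:R.
Proof.
have np1 := cbmeas_p1; have np2 := cbmeas_p2; have np2c := cbmeas_conj _ np2.
have := divergence_eq0 _ _ (fun j k =>
  isDerM _ _ _ _ (isDer_coe2 j k) (isDer_conj _ _ isDer_p2)).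
rewrite (eq_cE _ _ (fun u => (n%:R + 2) * (p2 u * conjc (p2 u)) +
  (p1 u * p1 u * conjc (p2 u) + - (4 * n%:R)))) => [|u uU].
  have nA : cbmeas (fun u => p2 u * conjc (p2 u)) by exact: cbmeasM.
  have nB : cbmeas (fun u => p1 u * p1 u * conjc (p2 u)).
    by apply: cbmeasM => //; exact: cbmeasM.
  rewrite cED; last 2 first.
  - by apply: cbmeasM => //; exact: cbmeas_cst.
  - by apply: cbmeasD => //; exact: cbmeas_cst.
  rewrite cEZ// cED// ?cE_cst//; last exact: cbmeas_cst.
  by rewrite addrA => /eqP; rewrite subr_eq0 => /eqP.
transitivity ((\sum_j \sum_k ((j == j)%:R * coe2 u k k + coe u j k * coe u j k
    + coe u j j * coe u k k + (j == k)%:R * coe2 u j k)) * conjc (p2 u)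
    - 4 * \sum_j \sum_k coe2 u j k * conjc (coe2 u j k)).
  rewrite mulr_suml mulr_sumr -sumrB; apply: eq_bigr => j _.
  rewrite mulr_suml mulr_sumr -sumrB; apply: eq_bigr => k _.
  by rewrite conjcM (conjc_nat _ 4) (coe2_sym u k); ring.
rewrite sum_div_coe2 unitary_sumsq; first by ring.
by rewrite /coe2 unitary_mul coe_unitary.
Qed.

(** Differentiating p_1 contributes 2 |p_2|^2, as the sum of the g_jk^2 is p_2; differentiating conj
    p_2 contributes -4 |p_1|^2 by [sum_coe_coe2]. *)
Lemma moment_p1p1p2 : (n%:R + 1) * B + 2 * A = 4 * C11.
Proof.
have np1 := cbmeas_p1; have np2 := cbmeas_p2; have np2c := cbmeas_conj _ np2.
have np1c := cbmeas_conj _ np1.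
have := divergence_eq0 _ _ (fun j k => isDerM _ _ _ _ (isDer_coe j k)
  (isDerM _ _ _ _ isDer_p1 (isDer_conj _ _ isDer_p2))).
rewrite (eq_cE _ _ (fun u => (n%:R + 1) * (p1 u * p1 u * conjc (p2 u)) +
  (2 * (p2 u * conjc (p2 u)) + - 4 * (p1 u * conjc (p1 u))))) => [|u uU].
  have nA : cbmeas (fun u => p2 u * conjc (p2 u)) by exact: cbmeasM.
  have nB : cbmeas (fun u => p1 u * p1 u * conjc (p2 u)).
    by apply: cbmeasM => //; exact: cbmeasM.
  have nC : cbmeas (fun u => p1 u * conjc (p1 u)) by exact: cbmeasM.
  have nZ (k : C) psi : cbmeas psi -> cbmeas (fun u : M => k * psi u).
    by move=> npsi; apply: cbmeasM => //; exact: cbmeas_cst.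
  rewrite cED; [|exact: nZ|by apply: cbmeasD; exact: nZ].
  rewrite cEZ// cED; [|exact: nZ|exact: nZ].
  by rewrite !cEZ// addrA mulNr => /eqP; rewrite subr_eq0 => /eqP.
transitivity ((\sum_j \sum_k ((j == j)%:R * coe u k k + (j == k)%:R * coe u j k))
      * (p1 u * conjc (p2 u))
    + 2 * conjc (p2 u) * (\sum_j \sum_k coe u j k * coe u j k)
    - 4 * p1 u * \sum_j \sum_k coe u j k * conjc (coe2 u j k)).
  move: (p1 u) (p2 u) => x y.
  rewrite mulr_suml !mulr_sumr -big_split -sumrB; apply: eq_bigr => j _ /=.
  rewrite mulr_suml !mulr_sumr -big_split -sumrB; apply: eq_bigr => k _ /=.
  by rewrite conjcM (conjc_nat _ 4) (coe2_sym u k); ring.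
by rewrite sum_div_coe sum_coe_sq sum_coe_coe2//; ring.
Qed.

Lemma complex_Re_natl (k : nat) (z : C) : Re (k%:R * z) = k%:R * Re z.
Proof.
by rewrite -(rmorph_nat (real_complex R)) complex_ReM /= mul0r subr0.
Qed.

(** Eliminating b gives N (N + 3) a = 4 N (N + 1) - 4 c; as Re c >= 0, this leaves Re a <= 4 (N + 1)
    / (N + 3). *)
Lemma moment_bound (N : nat) (a b c : C) : (0 < N)%N -> 0 <= Re c ->
  (N%:R + 2) * a + b = 4 * N%:R -> (N%:R + 1) * b + 2 * a = 4 * c -> Re a <= 4.
Proof.
move=> N0 c0; rewrite -natrD -[4 * N%:R]mulr1 -natrM -(natrD _ N 1).
move=> /(congr1 (@Re R)) + /(congr1 (@Re R)).
rewrite !complex_ReD !complex_Re_natl /= mulr1 natrM !natrD.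
have : 1 <= N%:R :> R by rewrite ler1n.
move: (Re a) (Re b) (Re c) c0 (N%:R : R) => x y z z0 t t1 e1 e2.
have tx : t * (t + 3) * x <= 4 * t * (t + 1).
  have -> : t * (t + 3) * x =
    (t + 1) * ((t + 2) * x + y) - ((t + 1) * y + 2 * x) by ring.
  by rewrite e1 e2; lra.
rewrite -(@ler_pM2l _ (t * (t + 3))); last by nra.
by apply: le_trans tx _; nra.
Qed.

Lemma rE_p2_sq : (0 < n)%N -> rE mu (fun u => Re (p2 u) ^+ 2) <= 4.
Proof.
move=> n0; have np1 := cbmeas_p1; have np2 := cbmeas_p2.
have nA := cbmeas_Re _ (cbmeasM _ _ np2 (cbmeas_conj _ np2)).
have nC := cbmeas_Re _ (cbmeasM _ _ np1 (cbmeas_conj _ np1)).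
have A4 : Re A <= 4.
  apply: (moment_bound n A B C11) moment_p2 moment_p1p1p2 => //.
  apply: Rintegral_ge0 => u _.
  by have := mulcJ_ge0 (p1 u); rewrite lecE => /andP[].
apply: le_trans A4; apply: le_rE => //.
  exact: rbmeasM (cbmeas_Re _ np2) (cbmeas_Re _ np2).
move=> u _; rewrite complex_ReM; case: (p2 u) => x y /=.
by have := sqr_ge0 y; rewrite !expr2; lra.
Qed.

End coe.

(** * Normal approximation of the trace *)

Lemma probability_setI {d} {T : measurableType d} {R : realType}
    (P : probability T R) (A D : set T) :
  measurable A -> measurable D -> P D = 1%E -> P (A `&` D) = P A.
Proof.
move=> mA mD PD.
rewrite [RHS](measureDI P mA mD) [X in (X + _)%E](_ : _ = 0%E) ?add0e//.
apply: (@subset_measure0 _ _ _ P _ (~` D)) => //.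
- exact: measurableD.
- exact: measurableC.
- by apply: etrans (probability_setC P mD) _; rewrite PD subee.
Qed.

Lemma measurable_le_real {d} {T : measurableType d} {R : realType}
    (x : R) (f : T -> R) :
  measurable_fun setT f -> measurable [set t | f t <= x].
Proof.
move=> mf; rewrite (_ : [set t | _] = f @^-1` `]-oo, x]); last first.
  by apply/seteqP; split=> t /=; rewrite in_itv.
by rewrite -[X in measurable X]setTI; apply: mf.
Qed.

Section stein_coe.
Context {R : realType} {n : nat} (mu : probability (borel_mx R n) R).
Context (haar_mu : haar_unitary mu).
Context (n_gt0 : (0 < n)%N).
Notation C := R[i].
Notation M := 'M[C]_n.
Implicit Types (u v : M).

Let s : R := Num.sqrt (1 + n%:R^-1).

Lemma scaled_traceE (g : M) : scaled_trace g = s * Re (\tr g).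
Proof.
rewrite /scaled_trace -/s.
have -> : 2^-1 * s%:C * (\tr g + conjc (\tr g)) = (s * Re (\tr g))%:C :> C.
  rewrite addcJ rmorphM/= mulrACA mulVf ?mul1r//.
by [].
Qed.

Definition W u : R := s * Re (p1 u).

Lemma sqr_s : s ^+ 2 = (n%:R + 1) / n%:R.
Proof.
have n0 : n%:R != 0 :> R by rewrite pnatr_eq0 -lt0n.
by rewrite sqr_sqrtr ?addr_ge0// mulrDl mulfV// mul1r.
Qed.

Lemma isDer_W : isDer (fun u => (W u)%:C)
  (fun j k u => s%:C * (coe u j k - conjc (coe u j k))).
Proof.
have h := isDerM _ _ _ _ (@isDer_cst R n (s%:C / 2))
  (isDerD _ _ _ _ isDer_p1 (isDer_conj _ _ isDer_p1)).
have two0 : 2 != 0 :> C by rewrite pnatr_eq0.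
apply: isDer_ext h => [u|j k u].
  by rewrite addcJ /W rmorphM/=; field.
by rewrite conjcM (conjc_nat _ 2) (coe_sym u k); field.
Qed.

Lemma rbmeas_W : rbmeas W.
Proof. exact: cbmeas_Re (isDer_cbmeas _ _ isDer_W). Qed.

(** The field g_jk F(W) has divergence (n + 1) p_1 F(W) + s dF(W) (p_2 - n), where n is the sum of
    |g_jk|^2; [G] is its real part. *)
Lemma stein_identity (F dF : R -> R) :
  stein_test F dF ->
  rE mu (fun u => dF (W u) - W u * F (W u)) =
  rE mu (fun u => n%:R^-1 * (dF (W u) * Re (p2 u))).
Proof.
move=> tF; have [dFF cdF dF2 _] := tF.
have dFW := isDer_comp _ _ _ _ isDer_W tF.
have rW := rbmeas_W.
have rFW : rbmeas (fun u => F (W u)) := cbmeas_Re _ (isDer_cbmeas _ _ dFW).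
have rdFW : rbmeas (fun u => dF (W u)).
  exact: rbmeas_comp cdF dF2 rW.
have rp1 := cbmeas_Re _ (@cbmeas_p1 R n); have rp2 := cbmeas_Re _ (@cbmeas_p2 R n).
pose G u : R := (n%:R + 1) * (Re (p1 u) * F (W u)) +
   (s * (dF (W u) * Re (p2 u)) + (- (s * n%:R)) * dF (W u)).
have rG : rbmeas G.
  apply: rbmeasD; first by apply: rbmeasZ; exact: rbmeasM.
  by apply: rbmeasD; apply: rbmeasZ => //; exact: rbmeasM.
have EG : rE mu G = 0.
  have := divergence_eq0 mu haar_mu _ _
    (fun j k => isDerM _ _ _ _ (isDer_coe j k) dFW).
  move=> /(congr1 (@complex.Re R)) /= <-; apply: eq_rE => u uU.
  transitivity (Re ((n%:R + 1) * p1 u * (F (W u))%:C +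
     (s * dF (W u))%:C * (p2 u - n%:R))).
    rewrite complex_ReD -(natrD _ n 1) -mulrA complex_Re_natl natrD complex_ReM /=.
    rewrite mulr0 subr0 complex_ReM /= mul0r subr0 complex_ReB.
    rewrite -(rmorph_nat (real_complex R)) /= /G; ring.
  rewrite -sum_div_coe -sum_coe_sq -(unitary_sumsq _ (coe_unitary u uU)).
  congr Re; rewrite -sumrB mulr_suml mulr_sumr -big_split; apply: eq_bigr => j _ /=.
  rewrite -sumrB mulr_suml mulr_sumr -big_split; apply: eq_bigr => k _ /=.
  by rewrite rmorphM /=; ring.
have n0 : n%:R != 0 :> R by rewrite pnatr_eq0 -lt0n.
have n10 : n%:R + 1 != 0 :> R by rewrite gt_eqF// ltr_wpDl.
(* Adding E G = 0 with weight s / (n + 1) cancels W F(W); since s^2 = (n + 1) / n, it cancels the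
   lone dF(W) too. *)
rewrite -[LHS]addr0 -(mulr0 (s / (n%:R + 1))) -EG -rEZ//.
rewrite -rED; last 2 first.
- apply: rbmeasD => //.
  have -> : (fun u => - (W u * F (W u))) = (fun u => -1 * (W u * F (W u))).
    by apply/funext => u; rewrite mulN1r.
  by apply: rbmeasZ; exact: rbmeasM.
- exact: rbmeasZ.
apply: eq_rE => u _; rewrite /G /W.
transitivity (dF (W u) - s * Re (p1 u) * F (W u) + s * Re (p1 u) * F (W u)
  + s ^+ 2 / (n%:R + 1) * (dF (W u) * Re (p2 u) - n%:R * dF (W u))).
  by rewrite /W; field.
by rewrite sqr_s; field; rewrite n0 n10.
Qed.

(** The majorant r^2 / 4 + 1 of |r| is sharp at |r| = 2, so E r^2 <= 4 gives E |r| <= 2 for r = Re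
    p_2; the other factor 2 of the constant is the bound on dF. *)
Lemma stein_error (F dF : R -> R) :
  stein_test F dF ->
  `|rE mu (fun u => dF (W u) - W u * F (W u))| <= 4 / n%:R.
Proof.
move=> tF; have [_ cdF dF2 _] := tF; rewrite stein_identity//.
have n0 : 0 < n%:R :> R by rewrite ltr0n.
have rp2 := cbmeas_Re _ (@cbmeas_p2 R n).
have rdFW : rbmeas (fun u => dF (W u)).
  exact: rbmeas_comp cdF dF2 rbmeas_W.
have rsq : rbmeas (fun u => Re (p2 u) ^+ 2) by exact: rbmeasM.
have bound : rE mu (fun u => 2 / n%:R * (Re (p2 u) ^+ 2 / 4 + 1)) <= 4 / n%:R.
  have -> : (fun u : M => 2 / n%:R * (Re (p2 u) ^+ 2 / 4 + 1)) =
      (fun u => 2^-1 / n%:R * Re (p2 u) ^+ 2 + 2 / n%:R).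
    by apply/funext => u; field; rewrite gt_eqF.
  rewrite rED ?rE_cst ?rEZ//; [|exact: rbmeasZ|exact: rbmeas_cst].
  apply: (@le_trans _ _ (2^-1 / n%:R * 4 + 2 / n%:R)).
    by rewrite lerD2r ler_wpM2l ?rE_p2_sq// divr_ge0// ?ltW.
  by rewrite le_eqVlt; apply/orP; left; apply/eqP; field; rewrite gt_eqF.
apply: le_trans bound.
have rmaj : rbmeas (fun u => 2 / n%:R * (Re (p2 u) ^+ 2 / 4 + 1)).
  apply: rbmeasZ; apply: rbmeasD (rbmeas_cst 1).
  exact: rbmeasM rsq (rbmeas_cst _).
have rd : rbmeas (fun u => n%:R^-1 * (dF (W u) * Re (p2 u))).
  by apply: rbmeasZ; exact: rbmeasM.
have pt u : `|n%:R^-1 * (dF (W u) * Re (p2 u))| <=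
    2 / n%:R * (Re (p2 u) ^+ 2 / 4 + 1).
  (* AM-GM: [|r| <= r^2 / 4 + 1] *)
  rewrite !normrM (ger0_norm (x := n%:R^-1)) ?invr_ge0 ?(ltW n0)//.
  rewrite [2 / _]mulrC -mulrA ler_pM2l ?invr_gt0// ler_pM ?dF2//.
  rewrite -(real_normK (num_real (Re (p2 u)))); have := sqr_ge0 (`|Re (p2 u)| - 2).
  by rewrite sqrrB; lra.
rewrite ler_norml; apply/andP; split; last first.
  by apply: le_rE => // u _; rewrite (le_trans (ler_norm _)).
rewrite lerNl -mulN1r -rEZ//; apply: le_rE => //; first exact: rbmeasZ.
by move=> u _; rewrite mulN1r (le_trans (ler_norm _))// normrN.
Qed.

Lemma probability_rE (A : set (borel_mx R n)) : measurable A ->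
  fine (mu A) = rE mu (\1_A : M -> R).
Proof.
move=> mA; rewrite /rE /Rintegral integral_indic//; last exact: measurable_unitary.
congr fine; apply/esym/probability_setI => //; first exact: measurable_unitary.
by case: haar_mu.
Qed.

Lemma rbmeas_indic (A : set (borel_mx R n)) : measurable A -> rbmeas (\1_A : M -> R).
Proof.
move=> mA; split; first exact: measurable_indic.
by exists 1 => u _; rewrite /indic; case: (_ \in _); rewrite ?normr1 ?normr0.
Qed.

Definition Phi (x : R) : R := (Num.sqrt (2 * pi))^-1 * Gam x.

Lemma Phi_lipschitz x y : `|Phi x - Phi y| <= (Num.sqrt (2 * pi))^-1 * `|x - y|.
Proof.
have k0 : 0 <= (Num.sqrt (2 * pi))^-1 :> R by rewrite invr_ge0 ltW// sqrt2pi_gt0.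
rewrite /Phi -mulrBr normrM ger0_norm// ler_wpM2l// -[leRHS]mul1r.
apply: (is_derive_lipschitz _ _ _ _ _ is_derive_Gam) => z.
by rewrite ger0_norm ?gam_le1// ltW ?gam_gt0.
Qed.

(** The indicator of W <= x lies between the ramps on [x - e, x] and [x, x + e]. Each costs 4 / n,
    whatever e is, plus the variation of [Phi] over a step e. *)
Lemma dist_W_Phi x :
  `|fine (mu [set u : borel_mx R n | W u <= x]) - Phi x| <= 4 / n%:R.
Proof.
have mW : measurable_fun [set: borel_mx R n] (W : borel_mx R n -> R).
  by case: rbmeas_W.
have mA := measurable_le_real x _ mW.
rewrite probability_rE//; set A := [set u | _].
pose K : R := (Num.sqrt (2 * pi))^-1.
have K0 : 0 < K by rewrite invr_gt0 sqrt2pi_gt0.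
have rA := rbmeas_indic _ mA.
have Egc g F dF c : stein_test F dF -> (forall x, dF x - x * F x = g x - c) ->
    continuous g -> (forall x, 0 <= g x <= 1) ->
    rbmeas (fun u => g (W u)) /\ `|rE mu (fun u => g (W u)) - c| <= 4 / n%:R.
  move=> tF Fg cg g01; have rg : rbmeas (fun u => g (W u)).
    apply: (rbmeas_comp _ 1 _ cg) rbmeas_W => y.
    by have /andP[? ?] := g01 y; rewrite ger0_norm.
  split=> //; rewrite -[X in _ - X](rE_cst mu haar_mu) -mulN1r -rEZ; last exact: rbmeas_cst.
  rewrite -rED//; last exact: rbmeasZ (rbmeas_cst c).
  under eq_rE do rewrite mulN1r -Fg.
  exact: stein_error.
have key e : 0 < e -> `|rE mu (\1_A : M -> R) - Phi x| <= 4 / n%:R + K * e.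
  move=> e0; rewrite ler_distl; apply/andP; split.
    have [g [F [dF [c [SF Sg]]]]] := stein_solution (x - e) e e0.
    have [tF Fg /andP[cx _]] := SF; have [cg g01 _ gx] := Sg.
    have [rg] := Egc _ _ _ _ tF Fg cg g01; rewrite ler_distl => /andP[le_c _].
    have le_A : rE mu (fun u => g (W u)) <= rE mu (\1_A : M -> R).
      apply: le_rE => // u _; have /andP[g0 g1] := g01 (W u).
      have [Wx|xW] := leP (W u) x; first by rewrite /indic mem_set.
      by rewrite (gx (W u)) /indic ?ler0n// subrK ltW.
    have := Phi_lipschitz x (x - e); rewrite (_ : x - (x - e) = e); last by ring.
    rewrite (gtr0_norm e0) -/K ler_distl => /andP[_]; rewrite -/(Phi _) in cx; lra.
  have [g [F [dF [c [SF Sg]]]]] := stein_solution x e e0.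
  have [tF Fg /andP[_ cx]] := SF; have [cg g01 gx _] := Sg.
  have [rg] := Egc _ _ _ _ tF Fg cg g01; rewrite ler_distl => /andP[_ le_c].
  have le_A : rE mu (\1_A : M -> R) <= rE mu (fun u => g (W u)).
    apply: le_rE => // u _; have /andP[g0 g1] := g01 (W u).
    have [Wx|xW] := leP (W u) x; first by rewrite gx// /indic; case: (_ \in _).
    by rewrite /indic memNset//= => /(lt_le_trans xW); rewrite ltxx.
  have := Phi_lipschitz (x + e) x; rewrite (_ : x + e - x = e); last by ring.
  rewrite (gtr0_norm e0) -/K ler_distl => /andP[_]; rewrite -/(Phi _) in cx; lra.
(* [K] is the Lipschitz constant of [Phi], so a ramp of width e / K costs an extra e. *)
apply/ler_addgt0Pr => e e0.
have := key (e / K); rewrite divr_gt0// => /(_ erefl).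
by rewrite mulrCA mulfV ?mulr1// gt_eqF.
Qed.

End stein_coe.

Theorem theorem4p16 (R : realType) (n : nat) (hn : (2 <= n)%N)
    (d : measure_display) (T : measurableType d) (P : probability T R)
    (g : {RV P >-> borel_mx R n}) (hg : circular_orthogonal_ensemble g)
    (x0 : R) :
  `| fine (P [set t | scaled_trace (g t) <= x0])
     - (Num.sqrt (2 * pi))^-1 *
       \int[@lebesgue_measure R]_(x in `]-oo, x0]) expR (- (x ^+ 2 / 2)) |
  <= 4 / n%:R.
Proof.
have n_gt0 : (0 < n)%N by exact: leq_trans hn.
case: hg => mu haar_mu lawE; have := dist_W_Phi mu haar_mu n_gt0 x0.
(* [W u] is the scaled trace of u u^T, so the law of g carries the event over once it is known to be
   measurable in the matrix space. *)
suff -> : mu [set u : borel_mx R n | W u <= x0] =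
    P [set t | scaled_trace (g t) <= x0] by [].
pose A : set (borel_mx R n) := [set m | scaled_trace m <= x0].
have mA : measurable A.
  apply: (measurable_le_real _ (fun m : borel_mx R n => scaled_trace m)).
  have [mtr _] : cmeasurable (fun m : 'M[R[i]]_n => \tr m).
    by apply: cmeasurable_sum => i; exact: cmeasurable_entry.
  rewrite (_ : (fun _ => _) = fun m : borel_mx R n =>
      Num.sqrt (1 + n%:R^-1) * complex.Re (\tr m)); last first.
    by apply/funext => m; exact: scaled_traceE.
  by apply: measurable_funM => //; exact: measurable_cst.
apply: etrans (esym (lawE A mA)); congr (mu _).
by apply/seteqP; split=> u /=; rewrite /A /mkset /= scaled_traceE.
Qed.
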